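(* Fix an odd integer $N\geqslant 0$. Let $n,k$ be positive integers with \[ \frac{n}{W(n)}\leqslant k\leqslant\frac{2n}{\log n+6} \] (equivalently $1\leqslant\lambda\leqslant\frac{2}{e^3}\cdot\frac{\sqrt n}{\log n+6}$). Then \[ S(n,k)=S_{ee}^{(N)}(n,k)+O_N\left(e^{-\lambda}\left(\frac{\lambda\log n}{\sqrt n}\right)^{N+1}\right), \] where \[ S_{ee}^{(N)}(n,k):=\sum_{0\leqslant s\leqslant N}\frac{1}{k^s}\sum_{j\geqslant 0}(-1)^j\frac{\lambda^j}{j!}\,c_s^{[\mathrm{ee}]}(n,j),\qquad c_s^{[\mathrm{ee}]}(n,j):=\sum_{\substack{m+l=s\\ m,l\geqslant 0}}a_m(j)\,\frac{\tau_l(n)}{l!}\,j^l . \]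
   Context: $S(n,k):=\left\{ n \atop k\right\}\frac{k!}{k^n}=\sum_{0\leqslant j\leqslant k}\binom{k}{j}(-1)^j\left(1-\frac jk\right)^n$, where $\left\{ n \atop k\right\}$ is the Stirling number of the second kind; $\lambda:=ke^{-n/k}$. The polynomials $a_m(x)$ are defined by $\prod_{0\leqslant l<j}(1-lt)=\sum_{m\geqslant 0}a_m(j)t^m$ for integers $j\geqslant 0$ (each $a_m$ is a polynomial of degree $2m$). The polynomials $\tau_l(n)$ are defined by $(e^x(1-x))^n=\sum_{l\geqslant 0}\frac{\tau_l(n)}{l!}x^l$. $W$ is the principal branch of the Lambert $W$-function; $O_N$ means the implied constant depends only on $N$; $\log$ is natural. *)

(* Defs.v *)
From HB Require Import structures.
From mathcomp Require Import all_boot all_order all_algebra.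
From mathcomp Require Import all_classical all_reals all_analysis.

Set Implicit Arguments.
Unset Strict Implicit.
Unset Printing Implicit Defensive.

Import Order.TTheory GRing.Theory Num.Theory.
Import numFieldNormedType.Exports.

Local Open Scope classical_set_scope.
Local Open Scope ring_scope.

(* Stirling number of the second kind: the partitions of an n-element set into
   k blocks ([finset.partition] excludes the empty block). *)
Definition stirling2 (n k : nat) : nat :=
  #|[set P : {set {set 'I_n}} | finset.partition P [set: 'I_n]%SET & #|P| == k]%SET|.

Definition Snk (R : realType) (n k : nat) : R :=
  (stirling2 n k * k`!)%:R / k%:R ^+ n.

(* Principal real branch of the Lambert function: on x >= 0 (indeed on
   x >= - exp (-1)) the defining set is a singleton; elsewhere the value is the
   irrelevant default 0. *)
Definition lambertW (R : realType) (x : R) : R :=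
  xget 0 [set w : R | -1 <= w /\ w * expR w = x].

Definition lambda (R : realType) (n k : nat) : R :=
  k%:R * expR (- (n%:R / k%:R)).

(* The value at the integer j of the polynomial a_m, that is, the coefficient of
   t^m in the product of the 1 - l t for l < j. *)
Definition a_coef (R : realType) (m j : nat) : R :=
  (\prod_(l < j) (1 - l%:R *: 'X) : {poly R})`_m.

(* tau R n l is tau_l(n), specified by the expansion
   (e^x (1 - x))^n = \sum_l tau_l(n) / l! x^l for all x. *)
Definition tau (R : realType) (n : nat) : nat -> R :=
  xget (fun=> 0) [set t : nat -> R | forall x : R,
    pseries (fun l => t l / l`!%:R) x @ \oo --> (expR x * (1 - x)) ^+ n].

Definition c_ee (R : realType) (s n j : nat) : R :=
  \sum_(m < s.+1) \sum_(l < s.+1 | (m + l == s)%N)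
    a_coef R m j * (tau R n l / l`!%:R) * j%:R ^+ l.

(* The inner series converges absolutely, c_ee R s n j being polynomial in j, so
   [limn] is the genuine sum. *)
Definition S_ee (R : realType) (N n k : nat) : R :=
  \sum_(s < N.+1) (k%:R ^+ s)^-1 *
    limn (series (fun j : nat =>
      (-1) ^+ j * (lambda R n k ^+ j / j`!%:R) * c_ee R s n j)).

Lemma lambertWP (R : realType) (x : R) : 0 <= x ->
  0 <= lambertW x /\ lambertW x * expR (lambertW x) = x.
Proof.
move=> x0.
have [_ E] : -1 <= lambertW x /\ lambertW x * expR (lambertW x) = x.
  apply: (@xgetPex _ 0 [set w : R | -1 <= w /\ w * expR w = x]).
  have xx : x <= x * expR x by rewrite ler_peMr// -expR0 ler_expR.
  have [||w] := @IVT R (fun w => w * expR w) 0 x x x0.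
  - apply: continuous_subspaceT => y.
    by apply: cvgM; [exact: cvg_id|exact: continuous_expR].
  - by rewrite mul0r ge_min x0 le_max xx orbT.
  - rewrite in_itv/= => /andP[w0 _] wx; exists w; split => //.
    by rewrite (le_trans _ w0)// lerN10.
by split => //; rewrite -(pmulr_lge0 _ (expR_gt0 (lambertW x))) E.
Qed.

Lemma tauP (R : realType) (n : nat) (x : R) :
  pseries (fun l => tau R n l / l`!%:R) x @ \oo --> (expR x * (1 - x)) ^+ n.
Proof.
suff [b bP] : exists b : nat -> R,
    forall x : R, pseries b x @ \oo --> (expR x * (1 - x)) ^+ n.
  move: x; apply: (@xgetPex _ (fun=> 0) [set t : nat -> R | forall x : R,
    pseries (fun l => t l / l`!%:R) x @ \oo --> (expR x * (1 - x)) ^+ n]).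
  exists (fun l => b l * l`!%:R) => x.
  rewrite [X in pseries X](_ : _ = b)//; apply/funext => l.
  by rewrite mulfK// pnatr_eq0 -lt0n fact_gt0.
suff [b bP] : exists b : nat -> R,
    forall x : R, pseries b x @ \oo --> expR (n%:R * x) * (1 - x) ^+ n.
  by exists b => y; rewrite exprMn -expRM_natl.
elim: {2}n => [|m [b bP]].
  exists (fun l => n%:R ^+ l / l`!%:R) => y.
  rewrite expr0 mulr1 (_ : pseries _ _ = series (exp_coeff (n%:R * y))).
    exact: is_cvg_series_exp_coeff.
  congr series; apply/funext => l.
  by rewrite /exp_coeff /= exprMn mulrAC.
exists (fun l => b l - (if l is l'.+1 then b l' else 0)) => y.
rewrite exprSr mulrA mulrBr mulr1.
rewrite -(cvg_shiftS (pseries _ y)).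
rewrite (_ : (fun _ => _) = (fun i => pseries b y i.+1 - pseries b y i * y)).
  apply: cvgB; first by rewrite (cvg_shiftS (pseries b y)); exact: bP.
  by apply: cvgMr_tmp; exact: bP.
apply/funext => i; rewrite /pseries /series /=.
rewrite big_distrl /= !big_mkord.
rewrite [X in _ - X](_ : _ = \sum_(l < i.+1)
    (if val l is l'.+1 then b l' else 0) * y ^+ l); last first.
  rewrite [RHS]big_ord_recl /= mul0r add0r.
  by apply: eq_bigr => l _; rewrite /= exprSr mulrA.
by rewrite -sumrB; apply: eq_bigr => l _; rewrite mulrBl.
Qed.

(* Main.v *)
(* With t = 1/k and H(j) = prod_{l<j} (1 - l t) (e^{jt} (1 - jt))^n,
   inclusion-exclusion reads S(n,k) = sum_j (-1)^j lambda^j / j! H(j), and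
   H(j) = sum_s t^s c_s(n,j).  The factor e^{-lambda} comes from cancellation:
   since sum_j (-lambda)^j / j! (j)_p = (-lambda)^p e^{-lambda}, the alternating
   sum of any combination phi of falling factorials is at most e^{-2 lambda}
   times the sum of lambda^j / j! g(j), where g is phi with absolute values on
   its coefficients.  For c_s such a majorant is obtained by replacing a_m and
   tau_l by their absolute values, because |a_m(j)| j^l is a nonnegative
   combination of falling factorials in j.

   The expansion of H is cut at an order L of size lambda + log n.  The orders
   N < s <= L are treated by cancellation; beyond L no cancellation is needed,
   because the remainder, weighted by lambda^j / j! and summed in absolute value,
   is already O(e^{-lambda} n^{-N-1}).  All the majorants come from
   sum_m |a_m(j)| u^m <= e^{j^2 u / 2} and from the coefficientwise bound of
   e^x (1 - x) by 1 + x^2 e^x / 2, evaluated at a weight u adapted to j. *)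

Require Import Defs.
From HB Require Import structures.
From mathcomp Require Import all_boot all_order all_algebra.
From mathcomp Require Import all_classical all_reals all_analysis.
From mathcomp Require Import ring lra.

Set Implicit Arguments.
Unset Strict Implicit.
Unset Printing Implicit Defensive.

Import Order.TTheory GRing.Theory Num.Theory.
Import numFieldNormedType.Exports.

Local Open Scope classical_set_scope.
Local Open Scope ring_scope.

(** * Surjections and inclusion-exclusion *)

(** The fibres of a surjection, listed by their values, label the blocks of a partition injectively,
    and each partition into k blocks has k! such labellings. *)
Lemma card_surj_stirling2 (n k : nat) :
  #|[set f : {ffun 'I_n -> 'I_k} | [forall i, [exists x, f x == i]]]%SET| =
  (stirling2 n k * k`!)%N.
Proof.
pose Q (g : {ffun 'I_k -> {set 'I_n}}) :=
  injectiveb g && finset.partition (g @: 'I_k)%SET [set: 'I_n]%SET.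
pose F (f : {ffun 'I_n -> 'I_k}) : {ffun 'I_k -> {set 'I_n}} :=
  [ffun i => [set x | f x == i]%SET].
have Finj : injective F.
  move=> f1 f2 /ffunP E; apply/ffunP => x.
  have /setP /(_ x) := E (f1 x); rewrite !ffunE !inE eqxx => /esym/eqP.
  by [].
transitivity #|[set g | Q g]%SET|.
  rewrite -(card_imset _ Finj); congr #|pred_of_set _|; apply/setP => g.
  rewrite inE; apply/imsetP/andP.
    case=> f; rewrite inE => /forallP fs ->; split.
      apply/injectiveP => i j /setP E.
      have /existsP[x /eqP fx] := fs i.
      by have := E x; rewrite !ffunE !inE fx eqxx => /esym/eqP.
    apply/and3P; split.
    - rewrite finset.eqEsubset finset.subsetT /=; apply/fintype.subsetP => x _.
      apply/finset.bigcupP; exists (F f (f x)); first exact: imset_f.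
      by rewrite ffunE inE.
    - apply/finset.trivIsetP => _ _ /imsetP[i _ ->] /imsetP[j _ ->] ij.
      rewrite -finset.setI_eq0; apply/eqP/setP => x; rewrite !ffunE !inE.
      by apply/negP => /andP[/eqP -> /eqP E]; rewrite E eqxx in ij.
    - apply/negP => /imsetP[i _ /setP E].
      by have /existsP[x fx] := fs i; have := E x; rewrite ffunE !inE fx.
  (* Conversely, a labelled partition comes from the map sending each point to the label of its
     unique block. *)
  case=> /injectiveP gI /and3P[/eqP cov triv n0].
  have ex x : exists i, x \in g i.
    have : x \in finset.cover (g @: 'I_k)%SET by rewrite cov.
    by case/finset.bigcupP => _ /imsetP[i _ ->]; exists i.
  have ex1 x i j : x \in g i -> x \in g j -> i = j.
    move=> xi xj; apply: gI; apply/eqP/negPn/negP => ij.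
    have := finset.trivIsetP triv _ _ (imset_f g (isT : i \in 'I_k))
                              (imset_f g (isT : j \in 'I_k)) ij.
    by rewrite -finset.setI_eq0 => /eqP/setP/(_ x); rewrite !inE xi xj.
  pose f := [ffun x => xchoose (ex x)].
  have fP x i : (f x == i) = (x \in g i).
    rewrite ffunE; have := xchooseP (ex x) => xP.
    apply/eqP/idP => [<- //|xi]; exact: ex1 xP xi.
  exists f; last by apply/ffunP => i; apply/setP => x; rewrite ffunE inE fP.
  rewrite inE; apply/forallP => i.
  have : g i != finset.set0.
    by apply: contra n0 => /eqP <-; exact: imset_f.
  by case/finset.set0Pn => x xi; apply/existsP; exists x; rewrite fP.
pose D := [set P : {set {set 'I_n}} |
  finset.partition P [set: 'I_n]%SET & #|P| == k]%SET.
pose im (g : {ffun 'I_k -> {set 'I_n}}) := (g @: 'I_k)%SET.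
rewrite -sum1_card (partition_big im (mem D)) /=; last first.
  move=> g; rewrite !inE => /andP[/injectiveP gI ->] /=.
  by rewrite card_imset // card_ord.
rewrite /stirling2 -sum_nat_const; apply: eq_bigr => P.
rewrite inE => /andP[Pp /eqP cP].
(* The labellings with image [P] are the injections into [P], counted by a falling factorial that
   equals k!. *)
rewrite sum1dep_card -[in RHS]cP -ffactnn.
rewrite (_ : #|P| ^_ #|P| = #|P| ^_ #|'I_k|)%N; last by rewrite card_ord cP.
rewrite -card_inj_ffuns_on; congr #|pred_of_set _|; apply/setP => g.
rewrite !inE; apply/andP/andP => [[/andP[gI gp] /eqP <-]|[/ffun_onP gP gI]].
  by split=> //; apply/ffun_onP => i; exact: imset_f.
have E : im g = P.
  apply/eqP; rewrite eqEcard card_imset ?card_ord ?cP ?leqnn ?andbT; last first.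
    exact/injectiveP.
  by apply/fintype.subsetP => _ /imsetP[i _ ->].
by rewrite /Q gI -/(im g) E Pp eqxx.
Qed.

(** The product over i of 1 - [i is missed by f] is 1 if f is onto and 0 otherwise. Expanding it
    over sets A of missed values leaves the maps into the complement of A. *)
Lemma card_surj_incl_excl (R : comNzRingType) (n k : nat) :
  #|[set f : {ffun 'I_n -> 'I_k} | [forall i, [exists x, f x == i]]]%SET|%:R =
  \sum_(j < k.+1) (-1) ^+ j * 'C(k, j)%:R * (k - j)%:R ^+ n :> R.
Proof.
pose miss (f : {ffun 'I_n -> 'I_k}) i := [forall x, f x != i].
transitivity (\sum_(f : {ffun 'I_n -> 'I_k})
    \prod_(i < k) (- (miss f i)%:R + 1 : R)).
  rewrite -sum1_card natr_sum big_mkcond /=; apply: eq_bigr => f _.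
  rewrite inE; case: ifPn => [/forallP fs|].
    rewrite big1 // => i _; rewrite (_ : miss f i = false) ?oppr0 ?add0r //.
    apply/negbTE; rewrite negb_forall; have /existsP[x fx] := fs i.
    by apply/existsP; exists x; rewrite negbK.
  rewrite negb_forall => /existsP[i /existsPn fi].
  rewrite (bigD1 i) //= (_ : miss f i = true) ?addNr ?mul0r //.
  exact/forallP.
transitivity (\sum_(A : {set 'I_k}) (-1) ^+ #|A| * (k - #|A|)%:R ^+ n : R).
  under eq_bigr do rewrite bigA_distr.
  rewrite exchange_big /=; apply: eq_bigr => A _.
  transitivity (\sum_(f : {ffun 'I_n -> 'I_k} | f \in ffun_on (mem (~: A)%SET))
      (-1) ^+ #|A| : R); last first.
    have cA : #|mem (~: A)%SET| = (k - #|A|)%N.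
      by rewrite [LHS](cardsCs (~: A)%SET) finset.setCK card_ord.
    by rewrite sumr_const card_ffun_on cA card_ord -natrX mulr_natr.
  rewrite [RHS]big_mkcond /=; apply: eq_bigr => f _; case: ifPn => fA.
    rewrite (eq_bigr (fun i => if i \in A then -1 else 1)); last first.
      move=> i _; case: ifPn => // iA; rewrite (_ : miss f i = true) //.
      apply/forallP => x; apply: contraTneq iA => <-.
      by have /ffun_onP/(_ x) := fA; rewrite inE.
    by rewrite -big_mkcond /= prodr_const.
  move: fA => /ffun_onP/existsNP[x].
  rewrite inE => /negP; rewrite negbK => fxA.
  rewrite (bigD1 (f x)) //= fxA (_ : miss f (f x) = false) ?oppr0 ?mul0r //.
  by apply/negbTE; rewrite negb_forall; apply/existsP; exists x; rewrite eqxx.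
have cA (A : {set 'I_k}) : (#|A| < k.+1)%N.
  by rewrite ltnS -[X in (_ <= X)%N](card_ord k) max_card.
rewrite (partition_big (fun A => Ordinal (cA A)) xpredT) //=.
apply: eq_bigr => j _.
rewrite (eq_bigr (fun=> (-1) ^+ j * (k - j)%:R ^+ n)); last first.
  by move=> A /eqP <-.
rewrite sumr_const -[LHS]mulr_natr [RHS]mulrAC; congr (_ * _%:R).
have := card_draws 'I_k j; rewrite [in RHS]card_ord => <-.
rewrite -cardsE; by congr #|pred_of_set _|; apply/setP => A; rewrite !inE.
Qed.

Lemma Snk_incl_excl (R : realType) (n k : nat) : (0 < k)%N ->
  Snk R n k =
  \sum_(j < k.+1) (-1) ^+ j * 'C(k, j)%:R * (1 - j%:R / k%:R) ^+ n.
Proof.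
move=> k0; have k0' : k%:R != 0 :> R by rewrite pnatr_eq0 -lt0n.
rewrite /Snk -card_surj_stirling2 card_surj_incl_excl mulr_suml.
apply: eq_bigr => j _; rewrite -[LHS]mulrA -expr_div_n; congr (_ * _ ^+ n).
by rewrite natrB -1?ltnS // mulrBl divff.
Qed.

(** * Cancellation in alternating Poisson sums *)

(** This cone is the class of functions whose alternating and plain Poisson sums can be compared. *)
Definition ffact_cone (R : realType) (p : nat) (g : nat -> R) : Prop :=
  exists b : nat -> R, (forall i, 0 <= b i) /\
    forall j, g j = \sum_(i < p) b i * (j ^_ i)%:R.

Lemma ffact_mulr (R : comPzRingType) (j i : nat) :
  (j ^_ i)%:R * j%:R = (j ^_ i.+1)%:R + i%:R * (j ^_ i)%:R :> R.
Proof.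
rewrite ffactnSr; have [ij|ji] := leqP i j; last by rewrite ffact_small // mul0n mul0r mulr0 addr0.
by rewrite -[X in _ * X%:R](subnK ij) natrD natrM; ring.
Qed.

Lemma ffact_cone_cst1 (R : realType) : ffact_cone 1 (fun=> 1 : R).
Proof. by exists (fun=> 1); split=> // j; rewrite big_ord1 ffactn0 mulr1. Qed.

(** The rule j (j)_i = (j)_{i+1} + i (j)_i has nonnegative coefficients. *)
Lemma ffact_cone_mulD (R : realType) (p : nat) (g : nat -> R) (c : R) :
  0 <= c -> ffact_cone p g -> ffact_cone p.+1 (fun j => g j * (j%:R + c)).
Proof.
move=> c0 [b [b0 gE]].
exists (fun i => (if i is i'.+1 then b i' else 0) +
                 (if (i < p)%N then (i%:R + c) * b i else 0)).
split=> [i|j].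
  by rewrite addr_ge0 //; [case: i | case: ifP => // _; rewrite mulr_ge0 // addr_ge0].
under eq_bigr do rewrite mulrDl; rewrite big_split /=.
rewrite big_ord_recl mul0r add0r /= [X in _ = _ + X]big_ord_recr /= ltnn mul0r addr0.
rewrite gE mulr_suml -big_split /=; apply: eq_bigr => i _.
by rewrite ltn_ord /bump /= add1n; have := ffact_mulr R j i; move: (_ ^_ _) => x; nra.
Qed.

(** Since (j+1)_{i+1} - (j)_{i+1} = (i+1) (j)_i, summation from 0 turns (j)_i into (j)_{i+1} /
    (i+1), and coefficients stay nonnegative. *)
Lemma ffact_cone_antidiff (R : realType) (p : nat) (g h : nat -> R) :
  g 0%N = 0 -> (forall j, g j.+1 = g j + h j) ->
  ffact_cone p h -> ffact_cone p.+1 g.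
Proof.
move=> g0 gS [b [b0 hE]].
exists (fun i => if i is i'.+1 then b i' / i%:R else 0); split.
  by case=> // i; rewrite divr_ge0.
move=> j; rewrite big_ord_recl mul0r add0r.
elim: j => [|j IH]; first by rewrite g0 big1 // => i _; rewrite ffact0n mulr0.
rewrite gS IH hE -big_split /=; apply: eq_bigr => i _; rewrite /bump /= add1n.
have i0 : i.+1%:R != 0 :> R by rewrite pnatr_eq0.
rewrite ffactSS natrM; have := ffact_mulr R j i => E.
have -> : (j ^_ i.+1)%:R = (j%:R - i%:R) * (j ^_ i)%:R :> R.
  by rewrite mulrBl (mulrC j%:R) E addrK.
by rewrite -[j.+1]addn1 -[i.+1]addn1 !natrD in i0 *; field.
Qed.

(** For m <= j this is the unsigned Stirling number of the first kind c(j, j - m). *)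
Definition a_abs (R : realType) (m j : nat) : R :=
  (\prod_(l < j) (1 + l%:R *: 'X) : {poly R})`_m.

Lemma a_abs0 (R : realType) (m : nat) : a_abs R m 0 = (m == 0)%:R.
Proof. by rewrite /a_abs big_ord0 coef1. Qed.

Lemma a_abs0S (R : realType) (j : nat) : a_abs R 0 j = 1.
Proof.
elim: j => [|j]; first by rewrite a_abs0.
rewrite /a_abs big_ord_recr /= mulrDr mulr1 coefD => ->.
by rewrite -scalerAr coefZ coefMX mulr0 addr0.
Qed.

Lemma a_absSS (R : realType) (m j : nat) :
  a_abs R m.+1 j.+1 = a_abs R m.+1 j + a_abs R m j * j%:R.
Proof.
rewrite /a_abs big_ord_recr /= mulrDr mulr1 coefD.
by rewrite -scalerAr coefZ coefMX mulrC.
Qed.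

Lemma a_coefE (R : realType) (m j : nat) : a_coef R m j = (-1) ^+ m * a_abs R m j.
Proof.
elim: j m => [|j IH] m.
  by rewrite /a_coef a_abs0 big_ord0 coef1; case: m => [|m]; rewrite ?mulr0 ?mul1r.
have E i : (\prod_(l < j) (1 - l%:R *: 'X) : {poly R})`_i = (-1) ^+ i * a_abs R i j.
  exact: IH.
rewrite /a_coef big_ord_recr /= mulrBr mulr1 coefB -scalerAr coefZ coefMX.
case: m => [|m] /=; first by rewrite E !a_abs0S mulr0 subr0.
by rewrite !E a_absSS exprS; ring.
Qed.

Lemma a_abs_ge0 (R : realType) (m j : nat) : 0 <= a_abs R m j.
Proof.
elim: j m => [|j IH] [|m]; rewrite ?a_abs0 ?a_abs0S ?a_absSS //.
by rewrite addr_ge0 // mulr_ge0.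
Qed.

(** As a function of j, |a_{m+1}| has difference j |a_m|, so it is an antidifference of an element
    of the cone; the powers of j are multiplied in afterwards. *)
Lemma ffact_cone_a_abs (R : realType) (m l : nat) :
  exists p, ffact_cone p (fun j => a_abs R m j * j%:R ^+ l).
Proof.
elim: l => [|l [p hp]]; last first.
  exists p.+1; move: (ffact_cone_mulD (lexx 0) hp).
  by congr ffact_cone; apply/funext => j; rewrite addr0 exprSr mulrA.
elim: m => [|m [p hp]].
  exists 1%N; move: (ffact_cone_cst1 R).
  by congr ffact_cone; apply/funext => j; rewrite a_abs0S mulr1.
exists p.+2; apply: ffact_cone_antidiff (ffact_cone_mulD (lexx 0) hp).
  by rewrite a_abs0 mul0r.
by move=> j; rewrite a_absSS !mulr1 addr0.
Qed.

(** Induction on i by an index shift: (j+1)_{i+1} / (j+1)! = (j)_i / j!. *)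
Lemma cvg_exp_ffact (R : realType) (x : R) (i : nat) :
  series (fun j => x ^+ j / j`!%:R * (j ^_ i)%:R) @ \oo --> x ^+ i * expR x.
Proof.
elim: i => [|i IH].
  rewrite expr0 mul1r (_ : (fun _ => _) = exp_coeff x).
    exact: is_cvg_series_exp_coeff.
  by apply/funext => j; rewrite ffactn0 mulr1.
rewrite -(cvg_shiftS (series _)) /= exprS -mulrA.
have -> : (fun J => series (fun j => x ^+ j / j`!%:R * (j ^_ i.+1)%:R) J.+1) =
    (fun J => x * series (fun j => x ^+ j / j`!%:R * (j ^_ i)%:R) J).
  apply/funext => J; rewrite /series /= big_nat_recl // ffact0n mulr0 add0r mulr_sumr.
  apply: eq_bigr => j _; rewrite ffactSS factS !natrM exprS.
  have f0 : j`!%:R != 0 :> R by rewrite pnatr_eq0 -lt0n fact_gt0.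
  have j0 : j.+1%:R != 0 :> R by rewrite pnatr_eq0.
  by move: j0 f0; move: j.+1%:R j`!%:R => a b a0 b0; field; rewrite a0 b0.
exact: cvgMl_tmp.
Qed.

(** The factor e^{-2 la} is the ratio of e^{-la} to e^{la}, the sums of the alternating and of the
    plain weights. Both convergences are bundled in so that the relation passes to linear
    combinations. *)
Definition alt_dom (R : realType) (la : R) (phi g : nat -> R) : Prop :=
  exists v G : R,
  [/\ series (fun j => (-1) ^+ j * (la ^+ j / j`!%:R) * phi j) @ \oo --> v,
      series (fun j => la ^+ j / j`!%:R * g j) @ \oo --> G &
      `|v| <= expR (- (2 * la)) * G].

Lemma alt_dom0 (R : realType) (la : R) : alt_dom la (fun=> 0) (fun=> 0).
Proof.
exists 0, 0; split; rewrite ?normr0 ?mulr0 //.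
  rewrite (_ : series _ = fun=> 0); first exact: cvg_cst.
  by apply/funext => J; rewrite /series /= big1 // => j _; rewrite mulr0.
rewrite (_ : series _ = fun=> 0); first exact: cvg_cst.
by apply/funext => J; rewrite /series /= big1 // => j _; rewrite mulr0.
Qed.

Lemma alt_domD (R : realType) (la : R) (f1 f2 g1 g2 : nat -> R) :
  alt_dom la f1 g1 -> alt_dom la f2 g2 ->
  alt_dom la (fun j => f1 j + f2 j) (fun j => g1 j + g2 j).
Proof.
move=> [v1 [G1 [c1 d1 e1]]] [v2 [G2 [c2 d2 e2]]].
exists (v1 + v2), (G1 + G2); split.
- rewrite (_ : (fun j => _) = (fun j => (-1) ^+ j * (la ^+ j / j`!%:R) * f1 j) +
    (fun j => (-1) ^+ j * (la ^+ j / j`!%:R) * f2 j)).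
    by rewrite seriesD; exact: cvgD.
  by apply/funext => j; rewrite mulrDr.
- rewrite (_ : (fun j => _) = (fun j => la ^+ j / j`!%:R * g1 j) +
    (fun j => la ^+ j / j`!%:R * g2 j)).
    by rewrite seriesD; exact: cvgD.
  by apply/funext => j; rewrite mulrDr.
- by rewrite mulrDr (le_trans (ler_normD _ _)) // lerD.
Qed.

Lemma alt_domZ (R : realType) (la c : R) (f g : nat -> R) :
  alt_dom la f g -> alt_dom la (fun j => c * f j) (fun j => `|c| * g j).
Proof.
move=> [v [G [c1 d1 e1]]].
exists (c * v), (`|c| * G); split.
- rewrite (_ : series _ =
      fun J => c * series (fun j => (-1) ^+ j * (la ^+ j / j`!%:R) * f j) J).
    exact: cvgMl_tmp.
  by apply/funext => J; rewrite /series /= mulr_sumr; apply: eq_bigr => j _;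
    rewrite mulrCA.
- rewrite (_ : series _ = fun J => `|c| * series (fun j => la ^+ j / j`!%:R * g j) J).
    exact: cvgMl_tmp.
  by apply/funext => J; rewrite /series /= mulr_sumr; apply: eq_bigr => j _;
    rewrite mulrCA.
- by rewrite normrM mulrCA ler_wpM2l.
Qed.

Lemma alt_dom_sum (R : realType) (la : R) (I : Type) (r : seq I) (P : pred I)
    (f g : I -> nat -> R) :
  (forall i, P i -> alt_dom la (f i) (g i)) ->
  alt_dom la (fun j => \sum_(i <- r | P i) f i j)
             (fun j => \sum_(i <- r | P i) g i j).
Proof.
move=> fg; elim: r => [|i r IH].
  under eq_fun do rewrite big_nil; under [X in alt_dom _ _ X]eq_fun do rewrite big_nil.
  exact: alt_dom0.
case Pi: (P i); under eq_fun do rewrite big_cons Pi;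
  under [X in alt_dom _ _ X]eq_fun do rewrite big_cons Pi; last exact: IH.
by apply: alt_domD => //; exact: fg.
Qed.

(** On one falling factorial the two sums are (-la)^i e^{-la} and la^i e^{la}, so the bound is an
    equality there; nonnegative coefficients let these bounds add up. *)
Lemma alt_dom_cone (R : realType) (la : R) (p : nat) (g : nat -> R) :
  0 <= la -> ffact_cone p g -> alt_dom la g g.
Proof.
move=> la0 [b [b0 gE]]; rewrite (_ : g = fun j => \sum_(i < p) b i * (j ^_ i)%:R).
  apply: alt_dom_sum => i _.
  rewrite [X in alt_dom _ _ X](_ : _ = fun j => `|b i| * (j ^_ i)%:R).
    apply: alt_domZ; exists ((- la) ^+ i * expR (- la)), (la ^+ i * expR la); split.
    - rewrite (_ : (fun j => _) = fun j => (- la) ^+ j / j`!%:R * (j ^_ i)%:R).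
        exact: cvg_exp_ffact.
      by apply/funext => j; rewrite [in RHS]exprNn !mulrA.
    - exact: cvg_exp_ffact.
    - rewrite normrM normrX normrN (ger0_norm la0) (ger0_norm (expR_ge0 _)).
      by rewrite mulrCA -expRD; apply: ler_wpM2l; rewrite ?exprn_ge0 // ler_expR; lra.
  by apply/funext => j; rewrite ger0_norm.
by apply/funext => j; rewrite gE.
Qed.

Lemma series_le_lim (R : realType) (u : nat -> R) (l : R) (J : nat) :
  (forall j, 0 <= u j) -> series u @ \oo --> l -> series u J <= l.
Proof.
move=> u0 ul; rewrite -(cvg_lim (@Rhausdorff R) ul).
apply: nondecreasing_cvgn_le; last by apply/cvg_ex; exists l.
by apply: nondecreasing_series => j _ _; exact: u0.
Qed.

(** Expanding (j + 1)^p in falling factorials gives moments la^i with i <= p, each at most la^p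
    because la >= 1. *)
Lemma poisson_moment (R : realType) (p : nat) : exists C : R, 0 <= C /\
  forall (la : R) (J : nat), 1 <= la ->
    \sum_(0 <= j < J) la ^+ j / j`!%:R * (j%:R + 1) ^+ p <= C * (expR la * la ^+ p).
Proof.
have [b [b0 bE]] : ffact_cone p.+1 (fun j => (j%:R + 1 : R) ^+ p).
  elim: p => [|p IH]; first exact: ffact_cone_cst1.
  under eq_fun do rewrite exprSr; exact: ffact_cone_mulD.
exists (\sum_(i < p.+1) b i); split=> [|la J la1]; first exact: sumr_ge0.
have la0 : 0 <= la by exact: le_trans la1.
under eq_bigr => j _ do rewrite bE mulr_sumr.
rewrite exchange_big /= mulr_suml; apply: ler_sum => i _.
under eq_bigr do rewrite mulrCA.
rewrite -mulr_sumr ler_wpM2l //.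
apply: (@le_trans _ _ (la ^+ i * expR la)); last first.
  by rewrite mulrC ler_wpM2l ?expR_ge0 // ler_weXn2l // -ltnS.
apply: (@series_le_lim R (fun j => la ^+ j / j`!%:R * (j ^_ i)%:R)).
  by move=> j; rewrite !mulr_ge0 ?exprn_ge0 ?invr_ge0.
exact: cvg_exp_ffact.
Qed.

(** * Cauchy products and the coefficients tau_l(n) / l! *)

(** The shape of the double sum copies the one in [c_ee], so that [c_ee_diag] holds by
    conversion. *)
Definition diag (V : nmodType) (F : nat -> nat -> V) (s : nat) : V :=
  \sum_(m < s.+1) \sum_(l < s.+1 | (m + l == s)%N) F m l.

Lemma diag_widen (V : nmodType) (F : nat -> nat -> V) (s K : nat) : (s < K)%N ->
  diag F s = \sum_(m < K) \sum_(l < K | (m + l == s)%N) F m l.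
Proof.
move=> sK; rewrite /diag.
rewrite (big_ord_widen_cond K xpredT
  (fun m => \sum_(l < s.+1 | (m + l == s)%N) F m l)) //= big_mkcond /=.
apply: eq_bigr => m _; case: ifPn => ms; last first.
  by rewrite big_pred0 // => l; apply/negP => /eqP E; case/negP: ms; rewrite ltnS -E leq_addr.
rewrite (big_ord_widen_cond K (fun l => m + l == s)%N (F m)) //=.
by apply: eq_bigl => l; case: eqP => //= <-; rewrite ltnS leq_addl.
Qed.

Lemma sum_diag (V : nmodType) (F : nat -> nat -> V) (L K : nat) : (L <= K)%N ->
  \sum_(s < L) diag F s = \sum_(m < K) \sum_(l < K | (m + l < L)%N) F m l.
Proof.
move=> LK; rewrite (eq_bigr (fun s : 'I_L =>
    \sum_(m < K) \sum_(l < K | (m + l == s)%N) F m l)); last first.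
  by move=> s _; apply: diag_widen; exact: leq_trans LK.
rewrite exchange_big /=; apply: eq_bigr => m _.
under eq_bigr do rewrite big_mkcond /=.
rewrite exchange_big /= [RHS]big_mkcond /=; apply: eq_bigr => l _.
rewrite -big_mkcond /=; case: ifPn => mlL; last first.
  by rewrite big_pred0 // => i; apply/negP => /eqP E; rewrite E ltn_ord in mlL.
by rewrite (big_pred1 (Ordinal mlL)) // => i; rewrite /= eq_sym -val_eqE.
Qed.

Lemma ler_norm_diag (R : realDomainType) (F : nat -> nat -> R) (s : nat) :
  `|diag F s| <= diag (fun m l => `|F m l|) s.
Proof.
apply: le_trans (ler_norm_sum _ _ _) _; apply: ler_sum => m _.
exact: ler_norm_sum.
Qed.

Lemma diagM_expr (R : comPzRingType) (F : nat -> nat -> R) (x : R) (s : nat) :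
  diag F s * x ^+ s = diag (fun m l => F m l * x ^+ (m + l)) s.
Proof.
rewrite /diag mulr_suml; apply: eq_bigr => m _.
by rewrite mulr_suml; apply: eq_bigr => l /eqP ->.
Qed.

Lemma eq_diag (V : nmodType) (F G : nat -> nat -> V) (s : nat) :
  (forall m l, F m l = G m l) -> diag F s = diag G s.
Proof. by move=> FG; apply: eq_bigr => m _; apply: eq_bigr => l _. Qed.

Lemma sum_diag_le (R : realDomainType) (F : nat -> nat -> R) (K : nat) :
  (forall m l, 0 <= F m l) ->
  \sum_(s < K) diag F s <= \sum_(m < K) \sum_(l < K) F m l.
Proof.
move=> F0; rewrite (sum_diag _ (leqnn K)); apply: ler_sum => m _.
by rewrite [leLHS]big_mkcond; apply: ler_sum => l _; case: ifP.
Qed.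

(** Rankin's trick: every term outside the diagonals below L has m + l >= L, hence r^{m+l} >=
    r^L. *)
Lemma diag_tail (R : realFieldType) (F : nat -> nat -> R) (L K : nat) (r M : R) :
  1 <= r -> (L <= K)%N ->
  \sum_(m < K) \sum_(l < K) `|F m l| * r ^+ (m + l) <= M ->
  `|\sum_(m < K) \sum_(l < K) F m l - \sum_(s < L) diag F s| <= r ^- L * M.
Proof.
move=> r1 LK FM; have r0 : 0 < r by exact: lt_le_trans r1.
have -> : \sum_(m < K) \sum_(l < K) F m l - \sum_(s < L) diag F s =
    \sum_(m < K) \sum_(l < K) (if (m + l < L)%N then 0 else F m l).
  rewrite (sum_diag F LK) -sumrB; apply: eq_bigr => m _.
  rewrite [X in _ - X]big_mkcond -sumrB; apply: eq_bigr => l _.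
  by case: ifP; rewrite ?subrr ?subr0.
apply: (@le_trans _ _ (r ^- L * \sum_(m < K) \sum_(l < K) `|F m l| * r ^+ (m + l))).
  rewrite mulr_sumr; apply: le_trans (ler_norm_sum _ _ _) _.
  apply: ler_sum => m _; rewrite mulr_sumr; apply: le_trans (ler_norm_sum _ _ _) _.
  apply: ler_sum => l _; case: ltnP => mlL.
    by rewrite normr0 mulr_ge0 ?mulr_ge0 ?invr_ge0 ?exprn_ge0 // ltW.
  by rewrite mulrCA ler_peMr // ler_pdivlMl ?exprn_gt0 // mulr1 ler_weXn2l.
by rewrite ler_wpM2l // invr_ge0 exprn_ge0 // ltW.
Qed.

(** The Taylor coefficients of e^x (1 - x). *)
Definition q_coef (R : realType) (i : nat) : R := (1 - i%:R) / i`!%:R.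

Lemma cvg_q_coef (R : realType) (x : R) :
  pseries (q_coef R) x @ \oo --> expR x * (1 - x).
Proof.
rewrite (_ : pseries _ _ = fun J =>
    series (fun j => x ^+ j / j`!%:R * (j ^_ 0)%:R) J -
    series (fun j => x ^+ j / j`!%:R * (j ^_ 1)%:R) J).
  rewrite (_ : _ * _ = x ^+ 0 * expR x - x ^+ 1 * expR x); last first.
    by rewrite expr0 expr1; ring.
  by apply: cvgB; exact: cvg_exp_ffact.
apply/funext => J; rewrite /pseries /series /= -sumrB; apply: eq_bigr => j _.
by rewrite ffactn0 ffactn1 /q_coef; ring.
Qed.

(** The linear coefficient vanishes, and for i >= 2 the absolute value (i-1)/i! is at most half of
    1/(i-2)!. The sum is thus at most 1 + x^2 e^x / 2. *)
Lemma q_coef_norm (R : realType) (x : R) (K : nat) : 0 <= x ->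
  \sum_(i < K) `|q_coef R i| * x ^+ i <= expR (x ^+ 2 * expR x / 2).
Proof.
move=> x0; apply: (@le_trans _ _ (1 + x ^+ 2 * expR x / 2)); last exact: expR_ge1Dx.
have pos J : 0 <= \sum_(i < J) exp_coeff x i.
  by apply: sumr_ge0 => i _; exact: exp_coeff_ge0.
apply: (@le_trans _ _ (1 + x ^+ 2 / 2 * \sum_(i < K) exp_coeff x i)); last first.
  rewrite lerD2l [leRHS]mulrAC ler_wpM2l ?divr_ge0 ?exprn_ge0 //.
  rewrite -(big_mkord xpredT); apply: series_le_lim; last exact: is_cvg_series_exp_coeff.
  by move=> i; exact: exp_coeff_ge0.
have q0 : `|q_coef R 0| * x ^+ 0 = 1 by rewrite /q_coef subr0 divr1 normr1 mulr1.
have q1 : `|q_coef R 1| * x ^+ 1 = 0 by rewrite /q_coef subrr mul0r normr0 mul0r.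
case: K => [|[|K]].
- by rewrite !big_ord0 mulr0 addr0.
- by rewrite !big_ord1 q0 lerDl mulr_ge0 ?divr_ge0 ?exprn_ge0 ?exp_coeff_ge0.
rewrite 2!big_ord_recl q0 /= /bump /= addn0 q1 add0r lerD2l.
apply: (@le_trans _ _ (x ^+ 2 / 2 * \sum_(i < K) exp_coeff x i)); last first.
  rewrite ler_wpM2l ?divr_ge0 ?exprn_ge0 // !big_ord_recr /= -addrA lerDl.
  by rewrite addr_ge0 // exp_coeff_ge0.
rewrite mulr_sumr; apply: ler_sum => i _; rewrite /bump /= !add1n /q_coef /exp_coeff /=.
have f0 : 0 < i`!%:R :> R by rewrite ltr0n fact_gt0.
have i0 : 0 <= i%:R :> R by [].
rewrite !factS !natrM -(addn2 i) -[i.+1]addn1 !natrD normrM normfV.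
rewrite (ger0_norm (_ : 0 <= _ * _)); last by rewrite !mulr_ge0 ?addr_ge0.
rewrite (_ : 1 - (i%:R + 2) = - (i%:R + 1 : R)); last by lra.
rewrite normrN (ger0_norm (_ : 0 <= _ + 1)) ?addr_ge0 // exprD.
have -> : (i%:R + 1) / ((i%:R + 2) * ((i%:R + 1) * i`!%:R)) * (x ^+ i * x ^+ 2) =
    (x ^+ i / i`!%:R * x ^+ 2) / (i%:R + 2) :> R.
  by field; rewrite !lt0r_neq0 //; lra.
rewrite (_ : _ / 2 * _ = (x ^+ i / i`!%:R * x ^+ 2) / 2); last by ring.
rewrite ler_wpM2l ?mulr_ge0 ?exprn_ge0 ?invr_ge0 ?(ltW f0) //.
by rewrite lef_pV2 ?posrE; lra.
Qed.

Fixpoint q_pow (R : realType) (n : nat) : nat -> R :=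
  if n is n'.+1 then diag (fun i l => q_pow R n' i * q_coef R l)
  else fun i => (i == 0%N)%:R.

(** The weighted sum of absolute values is submultiplicative under Cauchy products. *)
Lemma q_pow_norm (R : realType) (n : nat) (x : R) (K : nat) : 0 <= x ->
  \sum_(i < K) `|q_pow R n i| * x ^+ i <= expR (x ^+ 2 * expR x / 2) ^+ n.
Proof.
move=> x0; elim: n => [|n IH].
  case: K => [|K]; first by rewrite big_ord0 expr0.
  by rewrite big_ord_recl /= normr1 expr0 mulr1 big1 ?addr0 // => i _; rewrite normr0 mul0r.
pose F i l := `|q_pow R n i * q_coef R l| * x ^+ (i + l).
apply: (@le_trans _ _ (\sum_(s < K) diag F s)).
  apply: ler_sum => s _ /=; rewrite -diagM_expr ler_wpM2r ?exprn_ge0 //.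
  exact: ler_norm_diag.
apply: le_trans (sum_diag_le _ _) _ => [m l|]; first by rewrite mulr_ge0 ?exprn_ge0.
rewrite exprSr (_ : \sum_(m < K) _ = (\sum_(i < K) `|q_pow R n i| * x ^+ i) *
    \sum_(i < K) `|q_coef R i| * x ^+ i).
  by apply: ler_pM IH (q_coef_norm _ x0) => //; apply: sumr_ge0 => i _;
    rewrite mulr_ge0 ?exprn_ge0.
rewrite mulr_suml; apply: eq_bigr => m _; rewrite mulr_sumr; apply: eq_bigr => l _.
by rewrite /F normrM exprD; ring.
Qed.

(** The product of two partial sums differs from the partial sum of the Cauchy product by terms with
    m + l >= K only; [diag_tail] with r = 2 makes these O(2^{-K}). *)
Lemma cvg_q_pow (R : realType) (n : nat) (x : R) :
  pseries (q_pow R n) x @ \oo --> (expR x * (1 - x)) ^+ n.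
Proof.
elim: n => [|n IH].
  rewrite expr0 -(cvg_shiftS (pseries _ _)) (_ : (fun _ => _) = fun=> 1).
    exact: cvg_cst.
  apply/funext => K; rewrite /pseries /series /= big_nat_recl //= mul1r.
  by rewrite big1 ?addr0 // => i _; rewrite mul0r.
pose F i l := q_pow R n i * x ^+ i * (q_coef R l * x ^+ l).
pose P K := pseries (q_pow R n) x K * pseries (q_coef R) x K.
rewrite exprSr; have cP : P @ \oo --> (expR x * (1 - x)) ^+ n * (expR x * (1 - x)).
  by apply: cvgM IH _; exact: cvg_q_coef.
rewrite -[X in _ --> X]subr0.
rewrite (_ : pseries _ _ = fun K => P K - (P K - pseries (q_pow R n.+1) x K)); last first.
  by apply/funext => K; rewrite subKr.
apply: cvgB cP _.
(* The norm bounds of both factors at 2 |x|, multiplied; the result is independent of K. *)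
pose M := expR ((2 * `|x|) ^+ 2 * expR (2 * `|x|) / 2) ^+ n.+1.
have x20 : 0 <= 2 * `|x| by rewrite mulr_ge0.
have bnd K : `|P K - pseries (q_pow R n.+1) x K| <= 2 ^- K * M.
  rewrite (_ : P K = \sum_(m < K) \sum_(l < K) F m l); last first.
    rewrite /P /pseries /series /= !big_mkord mulr_suml; apply: eq_bigr => m _.
    by rewrite mulr_sumr.
  rewrite (_ : pseries _ _ _ = \sum_(s < K) diag F s); last first.
    rewrite /pseries /series /= big_mkord; apply: eq_bigr => s _.
    by rewrite diagM_expr; apply: eq_diag => i l; rewrite /F exprD; ring.
  apply: diag_tail => //; first by rewrite ler1n.
  rewrite /M exprSr (_ : \sum_(m < K) _ =
    (\sum_(i < K) `|q_pow R n i| * (2 * `|x|) ^+ i) *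
    \sum_(i < K) `|q_coef R i| * (2 * `|x|) ^+ i).
    apply: ler_pM (q_pow_norm _ _ x20) (q_coef_norm _ x20) => //;
      by apply: sumr_ge0 => i _; rewrite mulr_ge0 ?exprn_ge0.
  rewrite mulr_suml; apply: eq_bigr => m _; rewrite mulr_sumr; apply: eq_bigr => l _.
  by rewrite /F !normrM !normrX !exprMn exprD; ring.
apply: norm_cvg0; apply: (@squeeze_cvgr _ _ _ _ (fun=> 0) (geometric M 2^-1)).
- by near=> K; rewrite normr_ge0 /= exprVn mulrC; exact: bnd.
- exact: cvg_cst.
- by apply: cvg_geometric; rewrite ger0_norm ?invr_ge0 // invf_lt1 // ltr1n.
Unshelve. all: by end_near. Qed.

(** The lowest nonzero coefficient would dominate near 0: once the lower ones vanish, |d_m| x^m <= C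
    x^{m+1} with C independent of x. *)
Lemma pseries_eq0 (R : realType) (d : nat -> R) :
  (forall x, pseries d x @ \oo --> (0 : R)) -> d = fun=> 0.
Proof.
move=> d0; apply/funext => m; elim/ltn_ind: m => m IH.
(* Convergence at 2 gives absolute convergence at 1, hence one constant for all x in (0, 1]. *)
have abs1 : cvgn (pseries (fun i => `|d i|) 1).
  apply: (@is_cvg_pseries_inside_norm _ _ 2); last by rewrite !ger0_norm ?ltr1n.
  by apply/cvg_ex; exists 0; exact: d0.
pose C := limn (pseries (fun i => `|d i|) 1).
have C0 : 0 <= C by apply: limr_ge => //; apply: nearW => K; apply: sumr_ge0 => i _;
  rewrite mulr_ge0 ?exprn_ge0.
have bnd x K : 0 < x <= 1 -> (m < K)%N ->
    `|pseries d x K - d m * x ^+ m| <= x ^+ m.+1 * C.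
  move=> /andP[x0 x1] mK; apply: (@le_trans _ _ (x ^+ m.+1 * pseries (fun i => `|d i|) 1 K)).
    rewrite /pseries /series /= !big_mkord (bigD1 (Ordinal mK)) //= addrAC subrr add0r.
    rewrite mulr_sumr [leRHS](bigD1 (Ordinal mK)) //=.
    apply: le_trans (ler_norm_sum _ _ _) _.
    rewrite ler_wpDl ?mulr_ge0 ?exprn_ge0 // ?(ltW x0) //.
    apply: ler_sum => i im; rewrite expr1n mulr1 normrM normrX (gtr0_norm x0) mulrC.
    case: (ltngtP i m) => [lt|gt|/eqP E].
    - by rewrite IH // normr0 !mulr0.
    - by rewrite ler_wpM2r // ler_wiXn2l // ltW.
    - by case/negP: im; rewrite -val_eqE.
  rewrite ler_wpM2l ?exprn_ge0 ?(ltW x0) //; apply: series_le_lim => // i.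
  by rewrite mulr_ge0 ?exprn_ge0.
have small x : 0 < x <= 1 -> `|d m| <= x * C.
  move=> x01; have /andP[x0 x1] := x01.
  have : `|0 - d m * x ^+ m| <= x ^+ m.+1 * C.
    have cN : `|pseries d x K - d m * x ^+ m| @[K --> \oo] --> `|0 - d m * x ^+ m|.
      by apply: cvg_norm; apply: cvgB (d0 x) _; exact: cvg_cst.
    rewrite -(cvg_lim (@Rhausdorff R) cN); apply: limr_le; first by apply/cvg_ex; eexists; exact: cN.
    by exists m.+1 => // K /= mK; exact: bnd.
  rewrite sub0r normrN normrM normrX (gtr0_norm x0) exprSr -mulrA mulrC.
  by rewrite ler_pM2l // exprn_gt0.
apply/eqP; rewrite -normr_le0 leNgt; apply/negP => dm.
have C1 : 0 < C + 1 by rewrite ltr_wpDl.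
(* This makes x C <= |d_m| / 2; dividing by C + 1 covers the case C = 0. *)
pose x := Num.min 1 (`|d m| / (C + 1) / 2).
have x0 : 0 < x by rewrite lt_min ltr01 !divr_gt0.
have := small x; rewrite x0 ge_min lexx => /(_ isT).
apply/negP; rewrite -ltNge; apply: (@le_lt_trans _ _ (`|d m| / (C + 1) / 2 * (C + 1))).
  by rewrite ler_pM ?(ltW x0) // ?ge_min ?lexx ?orbT // lerDl.
by rewrite mulrAC divfK ?lt0r_neq0 // gtr_pMr // invf_lt1 // ltr1n.
Qed.

Definition tau_hat (R : realType) (n l : nat) : R := tau R n l / l`!%:R.

(** [tau] is chosen through its expansion only; uniqueness of coefficients identifies it with the
    explicit Cauchy powers, for which norm bounds are known. *)
Lemma tau_hatE (R : realType) (n : nat) : tau_hat R n = q_pow R n.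
Proof.
have /funeqP E : (fun l => tau_hat R n l - q_pow R n l) = fun=> 0.
  apply: pseries_eq0 => x; rewrite -(subrr ((expR x * (1 - x)) ^+ n)).
  rewrite (_ : pseries _ _ = fun K => pseries (tau_hat R n) x K - pseries (q_pow R n) x K).
    by apply: cvgB; [exact: tauP | exact: cvg_q_pow].
  apply/funext => K; rewrite /pseries /series /= -sumrB.
  by apply: eq_bigr => i _; rewrite mulrBl.
by apply/funext => l; apply/eqP; rewrite -subr_eq0 E.
Qed.

(** * Weighted majorants for a_m, tau_l and c_s *)

Lemma tau_hat_norm (R : realType) (n : nat) (x : R) (K : nat) : 0 <= x ->
  \sum_(i < K) `|tau_hat R n i| * x ^+ i <= expR (x ^+ 2 * expR x / 2) ^+ n.
Proof. by rewrite tau_hatE; exact: q_pow_norm. Qed.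

(** Each factor satisfies 1 + l u <= e^{l u}, and the sum of the l < j is at most j^2 / 2. *)
Lemma a_abs_norm (R : realType) (j : nat) (u : R) (K : nat) : 0 <= u ->
  \sum_(m < K) a_abs R m j * u ^+ m <= expR (j%:R ^+ 2 * u / 2).
Proof.
move=> u0; elim: j K => [|j IH] K.
  rewrite expr0n /= !mul0r expR0; case: K => [|K]; first by rewrite big_ord0.
  rewrite big_ord_recl a_abs0 mulr1 big1 ?addr0 // => i _.
  by rewrite a_abs0 mul0r.
case: K => [|K]; first by rewrite big_ord0 expR_ge0.
apply: (@le_trans _ _ (expR (j%:R ^+ 2 * u / 2) * (1 + j%:R * u))); last first.
  apply: (@le_trans _ _ (expR (j%:R ^+ 2 * u / 2) * expR (j%:R * u))).
    by rewrite ler_wpM2l ?expR_ge0 // expR_ge1Dx.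
  rewrite -expRD ler_expR -[j.+1%:R]natr1.
  rewrite (_ : (j%:R + 1) ^+ 2 * u / 2 = j%:R ^+ 2 * u / 2 + j%:R * u + u / 2).
    by rewrite lerDl divr_ge0.
  by field.
rewrite big_ord_recl a_abs0S mulr1.
under eq_bigr => m _ do rewrite /= /bump /= add1n a_absSS mulrDl.
rewrite big_split /= addrA mulrDr mulr1; apply: lerD.
  by have := IH K.+1; rewrite big_ord_recl a_abs0S mulr1.
rewrite (_ : \sum_(m < K) _ = (\sum_(m < K) a_abs R m j * u ^+ m) * (j%:R * u)).
  by rewrite ler_wpM2r ?mulr_ge0.
by rewrite mulr_suml; apply: eq_bigr => m _; rewrite exprS; ring.
Qed.

(** The first factor bounds the a_m at weight u, the second the tau_l at weight j u, because tau_l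
    enters c_s with the factor j^l. *)
Definition major (R : realType) (n j : nat) (u : R) : R :=
  expR (j%:R ^+ 2 * u / 2) *
  expR ((j%:R * u) ^+ 2 * expR (j%:R * u) / 2) ^+ n.

Lemma sum_major (R : realType) (n j : nat) (u : R) (K : nat) : 0 <= u ->
  \sum_(m < K) \sum_(l < K)
    (a_abs R m j * `|tau_hat R n l| * j%:R ^+ l) * u ^+ (m + l) <= major n j u.
Proof.
move=> u0; rewrite (_ : \sum_(m < K) _ = (\sum_(m < K) a_abs R m j * u ^+ m) *
    \sum_(l < K) `|tau_hat R n l| * (j%:R * u) ^+ l).
  apply: ler_pM; [| |exact: a_abs_norm|by apply: tau_hat_norm; rewrite mulr_ge0].
    by apply: sumr_ge0 => i _; rewrite mulr_ge0 ?a_abs_ge0 ?exprn_ge0.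
  by apply: sumr_ge0 => i _; rewrite mulr_ge0 ?exprn_ge0 ?mulr_ge0.
rewrite mulr_suml; apply: eq_bigr => m _; rewrite mulr_sumr; apply: eq_bigr => l _.
by rewrite exprMn exprD; ring.
Qed.

Definition c_abs (R : realType) (s n j : nat) : R :=
  diag (fun m l => a_abs R m j * `|tau_hat R n l| * j%:R ^+ l) s.

Lemma c_abs_ge0 (R : realType) (s n j : nat) : 0 <= c_abs R s n j.
Proof.
by apply: sumr_ge0 => m _; apply: sumr_ge0 => l _;
  rewrite !mulr_ge0 ?a_abs_ge0 ?exprn_ge0.
Qed.

Lemma c_ee_diag (R : realType) (s n j : nat) :
  c_ee R s n j = diag (fun m l => a_coef R m j * tau_hat R n l * j%:R ^+ l) s.
Proof. by []. Qed.

Lemma c_ee_norm (R : realType) (s n j : nat) : `|c_ee R s n j| <= c_abs R s n j.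
Proof.
rewrite c_ee_diag; apply: le_trans (ler_norm_diag _ _) _.
rewrite le_eqVlt; apply/orP; left; apply/eqP; apply: eq_diag => m l.
rewrite a_coefE !normrM !normrX normrN1 expr1n mul1r.
by rewrite (ger0_norm (a_abs_ge0 _ _ _)) normr_nat.
Qed.

Lemma sum_c_abs_le (R : realType) (n j K : nat) (u : R) : 0 <= u ->
  \sum_(s < K) u ^+ s * c_abs R s n j <= major n j u.
Proof.
move=> u0; apply: le_trans (sum_major n j K u0).
apply: (@le_trans _ _ (\sum_(s < K) diag (fun m l =>
    a_abs R m j * `|tau_hat R n l| * j%:R ^+ l * u ^+ (m + l)) s)).
  by apply: ler_sum => s _; rewrite mulrC diagM_expr.
by apply: sum_diag_le => m l; rewrite !mulr_ge0 ?a_abs_ge0 ?exprn_ge0.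
Qed.

(** The sign (-1)^m and tau_l(n) do not depend on j, so they act as scalars on the cone element
    |a_m(j)| j^l. *)
Lemma alt_dom_c_ee (R : realType) (la : R) (s n : nat) : 0 <= la ->
  alt_dom la (c_ee R s n) (c_abs R s n).
Proof.
move=> la0; rewrite /c_ee /c_abs /diag.
apply: alt_dom_sum => m _; apply: alt_dom_sum => l _.
have [p hp] := ffact_cone_a_abs R m l.
have := alt_domZ ((-1) ^+ m * tau_hat R n l) (alt_dom_cone la0 hp).
congr alt_dom; apply/funext => j; first by rewrite a_coefE /tau_hat; ring.
by rewrite normrM normrX normrN1 expr1n; ring.
Qed.

Lemma sum_a_coef (R : realType) (j K : nat) (t : R) : (j < K)%N ->
  \sum_(m < K) a_coef R m j * t ^+ m = \prod_(l < j) (1 - l%:R * t).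
Proof.
move=> jK; pose p : {poly R} := \prod_(l < j) (1 - l%:R *: 'X).
have sp : (size p <= K)%N.
  apply: leq_trans jK; rewrite /p {p}; elim: j => [|j IH].
    by rewrite big_ord0 size_poly1.
  rewrite big_ord_recr /=; apply: leq_trans (size_polyMleq _ _) _.
  have sq : (size (1 - j%:R *: 'X : {poly R})%R <= 2)%N.
    apply: leq_trans (size_polyD _ _) _; rewrite geq_max size_poly1 size_polyN /=.
    by apply: leq_trans (size_scale_leq _ _) _; rewrite size_polyX.
  by move: (leq_add IH sq); rewrite addn2; case: (_ + _)%N.
rewrite -(horner_coef_wide t sp) /p horner_prod; apply: eq_bigr => l _.
by rewrite !hornerE.
Qed.

Definition H_term (R : realType) (n j : nat) (t : R) : R :=
  (\prod_(l < j) (1 - l%:R * t)) * (expR (j%:R * t) * (1 - j%:R * t)) ^+ n.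

(** This is [diag_tail] for the double expansion of H, which raises the weight from t to r t. The
    tau series is infinite, so partial sums are estimated first. *)
Lemma H_term_tail (R : realType) (n j L : nat) (t r : R) : 0 <= t -> 1 <= r ->
  `|H_term n j t - \sum_(s < L) t ^+ s * c_ee R s n j| <= r ^- L * major n j (r * t).
Proof.
move=> t0 r1; have r0 : 0 <= r by exact: le_trans r1.
pose F m l := a_coef R m j * tau_hat R n l * j%:R ^+ l * t ^+ (m + l).
rewrite (_ : \sum_(s < L) _ = \sum_(s < L) diag F s); last first.
  by apply: eq_bigr => s _; rewrite mulrC c_ee_diag diagM_expr.
pose T := \sum_(s < L) diag F s.
pose u K := \prod_(l < j) (1 - l%:R * t) * pseries (tau_hat R n) (j%:R * t) K - T.
have cu : `|u K| @[K --> \oo] --> `|H_term n j t - T|.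
  apply: cvg_norm; apply: cvgB; last exact: cvg_cst.
  by apply: cvgMl_tmp; exact: tauP.
rewrite -(cvg_lim (@Rhausdorff R) cu); apply: limr_le.
  by apply/cvg_ex; eexists; exact: cu.
(* K > j makes the sum of the a_m the complete product, and K >= L puts all diagonals below L inside
   the square. *)
exists (maxn j.+1 L) => // K /=; rewrite geq_max => /andP[jK LK].
have -> : u K = \sum_(m < K) \sum_(l < K) F m l - T.
  rewrite /u -(sum_a_coef t jK) /pseries /series /= big_mkord; congr (_ - _).
  rewrite mulr_suml; apply: eq_bigr => m _; rewrite mulr_sumr; apply: eq_bigr => l _.
  by rewrite /F exprMn exprD; ring.
apply: diag_tail => //; apply: le_trans (sum_major n j K (mulr_ge0 r0 t0)).
apply: ler_sum => m _; apply: ler_sum => l _.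
rewrite /F !normrM !normrX (ger0_norm t0) normr_nat a_coefE normrM normrX normrN1.
by rewrite expr1n mul1r (ger0_norm (a_abs_ge0 _ _ _)) exprMn -!mulrA (mulrC (t ^+ _)).
Qed.

(** * The range of k *)

(** With W = W(n), n / W = e^W, while lambda >= 1 says e^{n/k} <= k. As e^{n/k} decreases in k and
    equals e^W at k = e^W, both conditions say k >= e^W. *)
Lemma lambda_ge1E (R : realType) (n k : nat) : (0 < n)%N -> (0 < k)%N ->
  (n%:R / lambertW (n%:R : R) <= k%:R) = (1 <= lambda R n k).
Proof.
move=> n0 k0; have n0' : 0 < n%:R :> R by rewrite ltr0n.
have k0' : 0 < k%:R :> R by rewrite ltr0n.
have [W0 WE] := lambertWP (ler0n R n); move: W0 WE; set W := lambertW _ => W0 WE.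
have Wp : 0 < W.
  by rewrite lt0r W0 andbT; apply/eqP => W0'; move: n0'; rewrite -WE W0' mul0r ltxx.
have -> : n%:R / W = expR W by rewrite -WE mulrC mulKf ?lt0r_neq0.
rewrite /lambda expRN ler_pdivlMr ?expR_gt0 // mul1r.
apply/idP/idP => [Wk|]; last apply: contraTT; rewrite -?ltNge => *.
  apply: (le_trans _ Wk); rewrite ler_expR ler_pdivrMr // -WE.
  by rewrite ler_wpM2l.
apply: (@lt_trans _ _ (expR W)) => //.
by rewrite ltr_expR ltr_pdivlMr // -WE ltr_pM2l.
Qed.

Lemma sqrt_expR (R : realType) (x : R) : 0 < x -> Num.sqrt x = expR (ln x / 2).
Proof.
move=> x0; rewrite -[in LHS](lnK (x := x)) ?posrE //.
rewrite (_ : ln x = ln x / 2 + ln x / 2); last by lra.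
by rewrite expRD -expr2 sqrtr_sqr ger0_norm ?expR_ge0 // -splitr.
Qed.

(** The map k -> k e^{-n/k} is increasing, and the right-hand bound is its value at K = 2n / (log n
    + 6), where n / K = log n / 2 + 3. *)
Lemma lambda_leE (R : realType) (n k : nat) : (0 < n)%N -> (0 < k)%N ->
  ((k%:R : R) <= 2 * n%:R / (ln (n%:R : R) + 6)) =
  (lambda R n k <= 2 / expR 3 * (Num.sqrt (n%:R : R) / (ln (n%:R : R) + 6))).
Proof.
move=> n0 k0; have n0' : 0 < n%:R :> R by rewrite ltr0n.
have k0' : 0 < k%:R :> R by rewrite ltr0n.
have l0 : 0 <= ln (n%:R : R) by rewrite ln_ge0 // ler1n.
set l := ln _ in l0 *; set K := 2 * n%:R / (l + 6).
have l6 : 0 < l + 6 by lra.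
have K0 : 0 < K by rewrite /K divr_gt0 // mulr_gt0.
have -> : 2 / expR 3 * (Num.sqrt n%:R / (l + 6)) = K * expR (- (n%:R / K)).
  have -> : n%:R / K = l / 2 + 3 by rewrite /K; field; rewrite !lt0r_neq0.
  have nE : n%:R = expR (l / 2) * expR (l / 2) :> R.
    by rewrite -expRD -splitr lnK.
  rewrite /K sqrt_expR // -/l expRN (expRD (l / 2) 3) nE.
  by field; rewrite !lt0r_neq0 ?expR_gt0.
rewrite /lambda; apply/idP/idP => [kK|]; last apply: contraTT; rewrite -?ltNge => *.
  rewrite ler_pM ?expR_ge0 ?(ltW k0') // ler_expR lerN2 ler_wpM2l ?(ltW n0') //.
  by rewrite lef_pV2.
rewrite ltr_pM ?expR_ge0 ?(ltW K0) // ltr_expR ltrN2 ltr_pM2l //.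
by rewrite ltf_pV2.
Qed.

Lemma range_bounds (R : realType) (n k : nat) : (0 < n)%N -> (0 < k)%N ->
  let l : R := ln n%:R in let w : R := Num.sqrt n%:R in
  let la : R := lambda R n k in
  1 <= la -> (k%:R : R) <= 2 * n%:R / (l + 6) ->
  [/\ 1 <= l, la * l <= w, l ^+ 2 <= 16 * w, (k%:R^-1 : R) * n%:R <= l &
      1 <= (k%:R^-1 : R) * n%:R].
Proof.
move=> n0 k0 l w la la1 kn.
have n0' : 0 < n%:R :> R by rewrite ltr0n.
have k0' : 0 < k%:R :> R by rewrite ltr0n.
have l0 : 0 <= l by rewrite ln_ge0 // ler1n.
have wE : w = expR (l / 2) by exact: sqrt_expR.
have w0 : 0 < w by rewrite wE expR_gt0.
have l6 : 0 < l + 6 by lra.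
have law : la * (l + 6) * expR 3 <= 2 * w.
  have : la <= 2 / expR 3 * (w / (l + 6)) by rewrite -lambda_leE.
  rewrite (_ : 2 / _ * _ = 2 * w / ((l + 6) * expR 3)).
    by rewrite ler_pdivlMr ?mulr_gt0 ?expR_gt0 // mulrA.
  by field; rewrite !lt0r_neq0 // expR_gt0.
have e3 : 4 <= expR 3 :> R by apply: le_trans (expR_ge1Dx 3); lra.
have e13 : expR 1 <= expR 3 :> R by rewrite ler_expR; lra.
have law2 : la * (l + 6) * 4 <= 2 * w.
  by apply: le_trans law; rewrite ler_wpM2l // mulr_ge0 ?(ltW l6) //; lra.
have kn' : k%:R <= n%:R :> R.
  apply: le_trans kn _; rewrite ler_pdivrMr // mulrC ler_wpM2l ?(ltW n0') //; lra.
split.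
(* This gives 6 e^3 <= 2 sqrt n, hence e <= sqrt n. *)
- have la6 : 6 <= la * (l + 6) by nra.
  have : expR 1 <= w.
    have : 6 * expR 3 <= la * (l + 6) * expR 3 by rewrite ler_wpM2r ?expR_ge0.
    by lra.
  rewrite wE ler_expR; lra.
- nra.
(* Here sqrt n = (e^{l/4})^2 >= (1 + l/4)^2. *)
- rewrite wE (_ : l / 2 = l / 4 + l / 4); last by lra.
  rewrite expRD; have := expR_ge1Dx (l / 4); move: (expR _) => x; nra.
(* lambda >= 1 means e^{n/k} <= k, and k <= n. *)
- rewrite mulrC -ler_expR /l lnK ?posrE //; apply: le_trans kn'.
  by move: la1; rewrite /la /lambda expRN ler_pdivlMr ?expR_gt0 // mul1r.
- by rewrite mulrC ler_pdivlMr // mul1r.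
Qed.

(** * S(n,k) as an alternating sum of the H(j) *)

Lemma prod_subr_ffact (R : comPzRingType) (k j : nat) :
  \prod_(l < j) (k%:R - l%:R) = (k ^_ j)%:R :> R.
Proof.
elim: j => [|j IH]; first by rewrite big_ord0 ffactn0.
by rewrite big_ord_recr /= IH mulrBr ffact_mulr [_ * j%:R]mulrC addrK.
Qed.

(** C(k,j) is k^j / j! times the product of the 1 - l/k, and the factor e^{-jn/k} inside lambda^j
    cancels the e^{jn/k} in H(j). *)
Lemma Snk_H_term (R : realType) (n k : nat) : (0 < k)%N ->
  Snk R n k = \sum_(j < k.+1)
    (-1) ^+ j * (lambda R n k ^+ j / j`!%:R) * H_term n j k%:R^-1.
Proof.
move=> k0; have k0' : k%:R != 0 :> R by rewrite pnatr_eq0 -lt0n.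
rewrite Snk_incl_excl //; apply: eq_bigr => j _; rewrite -!mulrA; congr (_ * _).
have f0 : j`!%:R != 0 :> R by rewrite pnatr_eq0 -lt0n fact_gt0.
have -> : 'C(k, j)%:R = (k ^_ j)%:R / j`!%:R :> R.
  by rewrite -bin_ffact natrM mulfK.
have -> : (k ^_ j)%:R = k%:R ^+ j * \prod_(l < j) (1 - l%:R * k%:R^-1) :> R.
  rewrite -prod_subr_ffact -[X in _ ^+ X](card_ord j) -prodr_const -big_split /=.
  by apply: eq_bigr => l _; rewrite mulrBr mulr1 mulrCA divff // mulr1.
rewrite /H_term /lambda exprMn -expRM_natl exprMn -expRM_natl.
have E : expR (j%:R * - (n%:R / k%:R)) * expR (n%:R * (j%:R / k%:R)) = 1 :> R.
  by rewrite -expRD (_ : _ + _ = 0) ?expR0 //; field.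
move: E; move: (expR _) (expR _) (\prod_(l < j) _) (_ ^+ n) (_ ^+ j) => x y p q r E.
by rewrite -[LHS]mulr1 -E; ring.
Qed.

(** Every factor lies in [0, 1]; for e^x (1 - x) this is 1 - x <= e^{-x}. *)
Lemma H_term_norm (R : realType) (n k j : nat) : (0 < k)%N -> (j <= k)%N ->
  `|H_term n j (k%:R^-1 : R)| <= 1.
Proof.
move=> k0 jk; have k0' : 0 < k%:R :> R by rewrite ltr0n.
have itv l : (l <= k)%N -> 0 <= 1 - l%:R / k%:R :> R.
  by move=> lk; rewrite subr_ge0 ler_pdivrMr // mul1r ler_nat.
rewrite ger0_norm /H_term.
  apply: mulr_ile1; first by apply: prodr_ge0 => l _; apply: itv;
    exact: leq_trans (ltnW (ltn_ord l)) jk.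
  - by rewrite exprn_ge0 // mulr_ge0 ?expR_ge0 // itv.
  - apply: prodr_ile1 => l _; rewrite itv ?gerBl ?divr_ge0 //.
    exact: leq_trans (ltnW (ltn_ord l)) jk.
  - rewrite exprn_ile1 ?mulr_ge0 ?expR_ge0 ?itv //.
    rewrite -[leRHS](@expRxMexpNx_1 R (j%:R / k%:R)) ler_wpM2l ?expR_ge0 //.
    by have := expR_ge1Dx (- (j%:R / k%:R) : R).
rewrite mulr_ge0 // ?exprn_ge0 ?mulr_ge0 ?expR_ge0 ?itv //.
by apply: prodr_ge0 => l _; apply: itv; exact: leq_trans (ltnW (ltn_ord l)) jk.
Qed.

(** The factor l = k is zero. This turns the finite sum for S(n,k) into a full series over j. *)
Lemma H_term0 (R : realType) (n k j : nat) : (0 < k)%N -> (k < j)%N ->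
  H_term n j (k%:R^-1 : R) = 0.
Proof.
move=> k0 kj; rewrite /H_term (bigD1 (Ordinal kj)) //= divff ?subrr ?mul0r //.
by rewrite pnatr_eq0 -lt0n.
Qed.

(** * Bounds on the expansion *)

Definition major_cap (R : realType) (b : R) : R := expR b * expR (b * expR b).

Lemma major_le_cap (R : realType) (n j : nat) (u b : R) : 0 <= u ->
  j%:R ^+ 2 * u <= b -> n%:R * (j%:R * u) ^+ 2 <= b -> j%:R * u <= b ->
  major n j u <= major_cap b.
Proof.
move=> u0 h1 h2 h3; have x0 : 0 <= j%:R * u by rewrite mulr_ge0.
have b0 : 0 <= b by exact: le_trans h3.
rewrite /major /major_cap -expRM_natl ler_pM ?expR_ge0 // ler_expR; first by lra.
rewrite -mulrA mulrA; apply: ler_pM => //.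
  by rewrite mulr_ge0 // exprn_ge0.
by rewrite ler_pdivrMr // (le_trans (_ : _ <= expR b)) ?ler_expR // ler_peMr ?expR_ge0 // ler1n.
Qed.

(** Applied with t = 1/k and w = sqrt n. Each estimate evaluates [major] at a weight where it is at
    most [kap]; the ratio of t to that weight gives the gain or the loss. In the third the weight is
    e t, with gain e^{-L-1}. *)
Lemma tail_bounds (R : realType) (N n L : nat) (t w B : R) :
  0 < t -> 0 < w -> w ^+ 2 = n%:R -> 1 <= t * n%:R -> (0 < L)%N -> 1 <= B ->
  (L%:R + 1) * t * w <= B ->
  let kap := major_cap ((expR 1 * B) ^+ 2) in
  [/\ forall j, (j <= L)%N -> \sum_(N.+1 <= s < L.+1) t ^+ s * c_abs R s n j <=
        kap * ((j%:R + 1) * (t * w)) ^+ N.+1,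
      forall j, (L < j)%N -> \sum_(s < L.+1) t ^+ s * c_abs R s n j <=
        kap * expR (2 * (j%:R - L%:R)) &
      forall j, (j <= L)%N -> `|H_term n j t - \sum_(s < L.+1) t ^+ s * c_ee R s n j| <=
        kap * expR (- L.+1%:R)].
Proof.
move=> t0 w0 wE tn L0 B1 LB kap.
set E := expR 1 in kap *.
have E1 : 1 <= E by rewrite -expR0 ler_expR.
have B0 : 0 < B by lra.
have EB1 : 1 <= E * B by rewrite mulr_ege1.
have EB0 : 0 <= E * B by exact: le_trans EB1.
have Lp : 0 < L%:R :> R by rewrite ltr0n.
have w1 : 1 <= w.
  rewrite -(@expr_ge1 _ 2) ?(ltW w0) // wE ler1n lt0n; apply: contraTneq tn => ->.
  by rewrite mulr0 ler10.
have tw0 : 0 < t * w by rewrite mulr_gt0.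
have Ltw : L%:R * (t * w) <= B by nra.
(* Since t w^2 = t n >= 1, L <= (L t w) w. *)
have Lw : L%:R <= B * w.
  rewrite -(ler_pM2r w0); apply: (@le_trans _ _ (L%:R * (t * w) * w ^+ 2)).
    rewrite wE (_ : _ * n%:R = L%:R * w * (t * n%:R)); last by ring.
    by rewrite ler_peMr // mulr_ge0 // ltW.
  by rewrite -[leRHS]mulrA -expr2 ler_wpM2r // exprn_ge0 // ltW.
have L2t : L%:R ^+ 2 * t <= B ^+ 2.
  rewrite expr2 -mulrA; apply: (@le_trans _ _ (B * w * (L%:R * t))).
    by rewrite ler_wpM2r // mulr_ge0 // ltW.
  by rewrite expr2 -mulrA ler_wpM2l ?(ltW B0) // mulrCA [w * t]mulrC.
(* n (j u)^2 is (j u w)^2, and j u <= j u w as w >= 1. *)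
have cap j u : 0 <= u -> j%:R * u * w <= E * B -> j%:R ^+ 2 * u <= (E * B) ^+ 2 ->
    major n j u <= kap.
  move=> u0 h1 h2; have ju0 : 0 <= j%:R * u by rewrite mulr_ge0.
  apply: major_le_cap => //.
    by rewrite mulrC -wE -exprMn ler_sqr ?nnegrE ?EB0 // mulr_ge0 // ltW.
  by rewrite (le_trans (_ : _ <= j%:R * u * w)) ?ler_peMr // (le_trans h1) // ler_eXnr.
have jLR j : (j <= L)%N -> j%:R <= L%:R :> R by rewrite ler_nat.
have BEB : B <= E * B by rewrite ler_peMl // ltW.
have BEB2 : B ^+ 2 <= (E * B) ^+ 2 by rewrite ler_sqr ?nnegrE ?EB0 ?(ltW B0).
split=> j jL.
- have j1 : 0 < j%:R + 1 :> R by rewrite ltr_wpDl.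
  have jw : 0 < (j%:R + 1) * w by rewrite mulr_gt0.
  (* This weight makes [n (j u)^2] bounded, and [(t / u) ^+ N.+1] is the gain. *)
  pose u := B / ((j%:R + 1) * w).
  have u0 : 0 < u by rewrite divr_gt0.
  have tu0 : 0 <= t / u by rewrite divr_ge0 // ltW.
  have ut : t / u = (j%:R + 1) * (t * w) / B.
    by rewrite /u; field; rewrite !lt0r_neq0.
  have tu : t / u <= 1.
    rewrite ut ler_pdivrMr // mul1r; apply: le_trans LB; rewrite -mulrA.
    by rewrite ler_wpM2r ?(ltW tw0) // lerD2r jLR.
  have major_u : major n j u <= kap.
    apply: cap; first exact: ltW.
      rewrite /u (_ : _ * _ * w = j%:R / (j%:R + 1) * B); last by field; rewrite !lt0r_neq0.
      by apply: le_trans BEB; rewrite ler_piMl ?(ltW B0) // ler_pdivrMr // mul1r lerDl.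
    apply: le_trans BEB2.
    rewrite /u (_ : _ * _ = j%:R / (j%:R + 1) * (j%:R * B / w)); last first.
      by field; rewrite !lt0r_neq0.
    apply: (@le_trans _ _ (j%:R * B / w)).
      by rewrite ler_piMl ?divr_ge0 ?mulr_ge0 ?(ltW w0) ?(ltW B0) // ler_pdivrMr // mul1r lerDl.
    rewrite ler_pdivrMr // expr2 mulrC -mulrA ler_wpM2l ?(ltW B0) //.
    exact: le_trans (jLR _ jL) Lw.
  (* For s > N, t^s = (t/u)^s u^s <= (t/u)^{N+1} u^s because t <= u. *)
  apply: (@le_trans _ _ ((t / u) ^+ N.+1 * \sum_(s < L.+1) u ^+ s * c_abs R s n j)).
    rewrite mulr_sumr -(big_mkord xpredT (fun s => (t / u) ^+ N.+1 * (u ^+ s * c_abs R s n j))).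
    have [NL|NL] := leqP N.+1 L.+1; last first.
      rewrite [leLHS]big_geq ?(ltnW NL) //; apply: sumr_ge0 => s _.
      by rewrite mulr_ge0 ?exprn_ge0 // mulr_ge0 ?exprn_ge0 ?c_abs_ge0 ?(ltW u0).
    rewrite [leRHS](big_cat_nat _ NL) //= ler_wpDl //.
      apply: sumr_ge0 => s _.
      by rewrite mulr_ge0 ?exprn_ge0 // mulr_ge0 ?exprn_ge0 ?c_abs_ge0 ?(ltW u0).
    rewrite big_nat_cond [leRHS]big_nat_cond; apply: ler_sum => s /andP[/andP[Ns _] _].
    rewrite mulrA ler_wpM2r ?c_abs_ge0 //.
    rewrite -[X in X ^+ s](divfK (lt0r_neq0 u0)) exprMn.
    rewrite ler_wpM2r ?exprn_ge0 ?(ltW u0) // ler_wiXn2l //.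
  rewrite mulrC; apply: ler_pM => //.
  - by apply: sumr_ge0 => s _; rewrite mulr_ge0 ?c_abs_ge0 ?exprn_ge0 // ltW.
  - by rewrite exprn_ge0.
  - by apply: le_trans major_u; apply: sum_c_abs_le; exact: ltW.
  - have x0 : 0 <= (j%:R + 1) * (t * w) by rewrite mulr_ge0 // ltW.
    rewrite ut lerXn2r ?nnegrE ?divr_ge0 ?(ltW B0) //.
    by rewrite ler_pdivrMr // ler_peMr.
- have j0 : 0 < j%:R :> R by rewrite ltr0n (leq_trans _ jL).
  have Lj : L%:R <= j%:R :> R by rewrite ler_nat ltnW.
  (* This weight keeps [j^2 u] equal to its value [L^2 t] at the cut. *)
  pose u := L%:R ^+ 2 * t / j%:R ^+ 2.
  have u0 : 0 < u by rewrite divr_gt0 ?mulr_gt0 ?exprn_gt0.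
  have tu : t / u = (j%:R / L%:R) ^+ 2 by rewrite /u; field; rewrite !lt0r_neq0.
  have jL1 : 1 <= j%:R / L%:R :> R by rewrite ler_pdivlMr // mul1r.
  have major_u : major n j u <= kap.
    apply: cap; first exact: ltW.
      rewrite /u (_ : _ * _ * w = L%:R / j%:R * (L%:R * (t * w))); last first.
        by field; rewrite !lt0r_neq0.
      apply: le_trans BEB; apply: le_trans Ltw.
      by rewrite ler_piMl ?mulr_ge0 ?(ltW t0) ?(ltW w0) // ler_pdivrMr // mul1r.
    rewrite /u mulrC divfK ?expf_neq0 ?lt0r_neq0 //; exact: le_trans BEB2.
  (* Here t >= u, so the loss (t/u)^s is largest at s = L. *)
  apply: (@le_trans _ _ ((t / u) ^+ L * \sum_(s < L.+1) u ^+ s * c_abs R s n j)).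
    rewrite mulr_sumr; apply: ler_sum => s _.
    rewrite mulrA ler_wpM2r ?c_abs_ge0 //.
    rewrite -[X in X ^+ s](divfK (lt0r_neq0 u0)) exprMn.
    rewrite ler_wpM2r ?exprn_ge0 ?(ltW u0) // ler_weXn2l -1?ltnS //.
    by rewrite tu exprn_ege1.
  rewrite mulrC; apply: ler_pM => //.
  - by apply: sumr_ge0 => s _; rewrite mulr_ge0 ?c_abs_ge0 ?exprn_ge0 // ltW.
  - by rewrite exprn_ge0 // divr_ge0 // ltW.
  - by apply: le_trans major_u; apply: sum_c_abs_le; exact: ltW.
  (* (j/L)^{2L} <= e^{2(j-L)}, by 1 + y <= e^y at y = j/L - 1. *)
  - rewrite tu -exprM (_ : 2 * (j%:R - L%:R) = (2 * L)%:R * (j%:R / L%:R - 1)); last first.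
      by rewrite natrM; field; rewrite lt0r_neq0.
    rewrite expRM_natl lerXn2r ?nnegrE ?expR_ge0 ?(le_trans ler01 jL1) //.
    by apply: le_trans (expR_ge1Dx _); rewrite addrC subrK.
- apply: le_trans (H_term_tail n j L.+1 (ltW t0) E1) _.
  rewrite mulrC expRN -[L.+1%:R]mulr1 expRM_natl ler_wpM2r ?invr_ge0 ?exprn_ge0 ?(le_trans ler01 E1) //.
  apply: cap; first by rewrite mulr_ge0 ?(ltW t0) // (le_trans ler01 E1).
    rewrite (_ : _ * _ * w = E * (j%:R * (t * w))); last by ring.
    rewrite ler_wpM2l ?(le_trans ler01 E1) //; apply: le_trans Ltw.
    by rewrite ler_wpM2r ?(ltW tw0) // jLR.
  rewrite mulrCA exprMn; apply: ler_pM; rewrite ?(le_trans ler01 E1) //.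
  + by rewrite mulr_ge0 ?exprn_ge0 // ltW.
  + by rewrite ler_eXnr.
  apply: le_trans L2t; rewrite ler_wpM2r ?(ltW t0) // ler_sqr ?nnegrE //.
  exact: jLR.
Qed.

(** * Summation over j and the final estimate *)

Lemma exp_sum_le (R : realType) (x : R) (J : nat) : 0 <= x ->
  \sum_(0 <= j < J) x ^+ j / j`!%:R <= expR x.
Proof.
move=> x0; apply: (@series_le_lim R (exp_coeff x)).
  by move=> j; exact: exp_coeff_ge0.
exact: is_cvg_series_exp_coeff.
Qed.

(** The factor e^{2j} is absorbed by replacing x with e^2 x; hence the constant e^2 in the cut
    order. *)
Lemma exp_tail_le (R : realType) (x y : R) (J : nat) : 0 <= x ->
  \sum_(0 <= j < J) x ^+ j / j`!%:R * expR (2 * (j%:R - y)) <=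
  expR (expR 2 * x - 2 * y).
Proof.
move=> x0; rewrite expRD -[leRHS]mulrC.
rewrite (eq_bigr (fun j => expR (- (2 * y)) * ((expR 2 * x) ^+ j / j`!%:R))).
  by rewrite -mulr_sumr ler_wpM2l ?expR_ge0 // exp_sum_le // mulr_ge0 ?expR_ge0.
move=> j _; rewrite mulrBr expRD mulrC (mulrC 2) expRM_natl exprMn; ring.
Qed.

Lemma series_sum_le (R : realType) (la : R) (f g : nat -> R) (K : nat) : 0 <= la ->
  (forall j, f j <= g j) ->
  \sum_(0 <= j < K) la ^+ j / j`!%:R * f j <= \sum_(0 <= j < K) la ^+ j / j`!%:R * g j.
Proof.
by move=> la0 fg; apply: ler_sum => j _; rewrite ler_wpM2l // divr_ge0 // exprn_ge0.
Qed.

Lemma error_bound (R : realType) (N : nat) : exists C : R, forall n k : nat,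
  (0 < n)%N -> (0 < k)%N -> 1 <= lambda R n k ->
  (k%:R : R) <= 2 * n%:R / (ln (n%:R : R) + 6) ->
  `|Snk R n k - S_ee R N n k| <=
    C * (expR (- lambda R n k) *
         (lambda R n k * ln (n%:R : R) / Num.sqrt (n%:R : R)) ^+ N.+1).
Proof.
have [Cp [Cp0 moment]] := poisson_moment R N.+1.
(* [B] bounds (L + 1) t w: c + 1 comes from the lambda part of the cut, 16 (N + 1) from its log n
   part and 32 from rounding. *)
pose c : R := expR 2; pose B : R := c + 1 + 16 * N.+3%:R.
pose kap := major_cap ((expR 1 * B) ^+ 2).
have kap0 : 0 <= kap by rewrite mulr_ge0 ?expR_ge0.
exists (1 + 3 * kap + kap * Cp) => n k n0 k0.
set la := lambda R n k; set l := ln _; set w := Num.sqrt _ => la1 kn.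
have [l1 law l2 tnl tn] := range_bounds n0 k0 la1 kn.
rewrite -/l -/w -/la in l1 law l2 tnl.
have n0' : 0 < n%:R :> R by rewrite ltr0n.
have w0 : 0 < w by rewrite sqrtr_gt0.
have wE : w ^+ 2 = n%:R by rewrite sqr_sqrtr // ltW.
pose t : R := k%:R^-1; rewrite -/t in tnl tn.
have t0 : 0 < t by rewrite invr_gt0 ltr0n.
have c1 : 1 <= c by rewrite -expR0 ler_expR.
have la0 : 0 <= la by lra.
have N0 : 0 <= N.+1%:R :> R by [].
(* Any L >= x makes both la - L and c la - 2 L at most -la - (N + 1) log n; the first uses c >=
   1. *)
pose x := (c + 1) * la + N.+1%:R * l.
have x0 : 0 <= x by rewrite addr_ge0 ?mulr_ge0 //; lra.
pose L := (Num.truncn x).+1.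
have [Lx xL] : L%:R <= x + 1 /\ x <= L%:R.
  have /andP[a b] := truncn_itv x0; split; last exact: ltW.
  by rewrite /L -natr1 lerD2r.
have w1 : 1 <= w.
  rewrite -(@expr_ge1 _ 2) ?(ltW w0) // wE ler1n //.
have twl : t * w <= l / w.
  by rewrite ler_pdivlMr // -mulrA -expr2 wE.
have lw2 : l ^+ 2 / w <= 16 by rewrite ler_pdivrMr.
have lw : l / w <= 16.
  apply: le_trans lw2; rewrite ler_wpM2r ?invr_ge0 ?(ltW w0) //; nra.
have lalw : la * (l / w) <= 1 by rewrite mulrA ler_pdivrMr // mul1r.
have LB : (L%:R + 1) * t * w <= B.
  have lw0 : 0 <= l / w by rewrite divr_ge0 ?(ltW w0) //; lra.
  rewrite -mulrA; apply: (@le_trans _ _ ((x + 2) * (l / w))).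
    apply: ler_pM => //; first by rewrite mulr_ge0 // ltW.
    by lra.
  rewrite (_ : (x + 2) * (l / w) = (c + 1) * (la * (l / w)) +
      (N.+1%:R * (l ^+ 2 / w) + 2 * (l / w))); last by rewrite /x; ring.
  rewrite (_ : B = (c + 1) + (N.+1%:R * 16 + 2 * 16)).
    by rewrite !lerD ?ler_wpM2l // ler_piMr //; lra.
  by rewrite /B -[N.+3]addn2 natrD; ring.
have B1 : 1 <= B.
  by rewrite /B; have : 0 <= N.+3%:R :> R by []; lra.
have [tail1 tail2 tail3] := tail_bounds N t0 w0 wE tn (ltn0Sn _ : (0 < L)%N) B1 LB.
rewrite -/kap in tail1 tail2 tail3.
have NL : (N.+1 <= L.+1)%N.
  rewrite ltnS -(ler_nat R); apply: le_trans xL; rewrite /x.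
  have := ler_wpM2l N0 l1; rewrite -natr1; nra.
pose al (f : nat -> R) : nat -> R := series (fun j : nat => (-1) ^+ j * (la ^+ j / j`!%:R) * f j).
(* The orders above N up to the cut, treated by cancellation; [Pt] is their majorant. *)
pose P j := \sum_(N.+1 <= s < L.+1) t ^+ s * c_ee R s n j.
pose Pt j := \sum_(N.+1 <= s < L.+1) t ^+ s * c_abs R s n j.
have [vP [G [cP cG vG]]] : alt_dom la P Pt.
  apply: alt_dom_sum => s _.
  have := alt_domZ (t ^+ s) (alt_dom_c_ee s n la0).
  by rewrite ger0_norm // exprn_ge0 // ltW.
have cS : al (fun j => H_term n j t) @ \oo --> Snk R n k.
  apply: cvg_near_cst; exists k.+1 => // K /= kK.
  rewrite /al /series /= (big_cat_nat (n := k.+1)) //= [X in _ + X]big1_seq ?addr0.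
    by rewrite big_mkord Snk_H_term.
  by move=> j /=; rewrite mem_index_iota => /andP[kj _]; rewrite H_term0 ?mulr0.
have cE : (fun K => \sum_(s < N.+1) t ^+ s * al (c_ee R s n) K) @ \oo --> S_ee R N n k.
  rewrite /S_ee; apply: cvg_big => [|s _]; first exact: add_continuous.
  rewrite -exprVn; apply: cvgMl_tmp.
  have [v [G' [cv _ _]]] := alt_dom_c_ee s n la0.
  by apply/cvg_ex; exists v.
pose bnd1 := kap * expR (la - L%:R) + (1 + kap) * expR (c * la - 2 * L%:R).
(* For j > L the two parts are bounded separately, by |H(j)| <= 1 <= e^{2(j-L)} and by [tail2]. *)
have rest j : `|H_term n j t - \sum_(s < L.+1) t ^+ s * c_ee R s n j| <=
    kap * expR (- L%:R) + (1 + kap) * expR (2 * (j%:R - L%:R)).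
  have [jL|Lj] := leqP j L.
    apply: le_trans (tail3 _ jL) _; rewrite ler_wpDr ?mulr_ge0 ?addr_ge0 ?expR_ge0 //.
    by rewrite ler_wpM2l // ler_expR lerN2 -[leRHS]natr1 lerDl.
  rewrite ler_wpDl ?mulr_ge0 ?expR_ge0 //; apply: le_trans (ler_normB _ _) _.
  rewrite mulrDl mul1r lerD //.
    apply: (@le_trans _ _ 1).
      have [jk|kj] := leqP j k; first exact: H_term_norm.
      by rewrite H_term0 ?normr0.
    rewrite -[leLHS]expR0 ler_expR mulr_ge0 // subr_ge0 ler_nat; exact: ltnW.
  apply: le_trans (tail2 _ Lj); apply: le_trans (ler_norm_sum _ _ _) _.
  apply: ler_sum => s _; rewrite normrM ger0_norm ?exprn_ge0 ?(ltW t0) //.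
  by rewrite ler_wpM2l ?exprn_ge0 ?(ltW t0) // c_ee_norm.
have splitP j : \sum_(s < L.+1) t ^+ s * c_ee R s n j =
    \sum_(s < N.+1) t ^+ s * c_ee R s n j + P j.
  rewrite -(big_mkord xpredT (fun s => t ^+ s * c_ee R s n j)).
  by rewrite (big_cat_nat _ NL) //= big_mkord.
(* Only the remainder past order L is left here, and it is summed in absolute value before passing
   to the limit. *)
have step1 : `|Snk R n k - S_ee R N n k - vP| <= bnd1.
  pose D K := al (fun j => H_term n j t) K - \sum_(s < N.+1) t ^+ s * al (c_ee R s n) K
              - al P K.
  have cD : `|D K| @[K --> \oo] --> `|Snk R n k - S_ee R N n k - vP|.
    by apply: cvg_norm; apply: cvgB cP; exact: cvgB cS cE.
  rewrite -(cvg_lim (@Rhausdorff R) cD); apply: limr_le.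
    by apply/cvg_ex; eexists; exact: cD.
  apply: nearW => K.
  have -> : D K = al (fun j => H_term n j t - \sum_(s < L.+1) t ^+ s * c_ee R s n j) K.
    rewrite /D /al /series /=.
    under [X in _ - X - _]eq_bigr do rewrite mulr_sumr.
    rewrite exchange_big /= -!sumrB; apply: eq_bigr => j _.
    rewrite splitP; under eq_bigr do rewrite mulrCA.
    by rewrite -mulr_sumr -!mulrBr opprD addrA.
  apply: le_trans (ler_norm_sum _ _ _) _.
  apply: (@le_trans _ _ (\sum_(0 <= j < K) la ^+ j / j`!%:R *
      (kap * expR (- L%:R) + (1 + kap) * expR (2 * (j%:R - L%:R))))).
    apply: le_trans (series_sum_le K la0 rest); apply: ler_sum => j _.
    by rewrite !normrM !normrX normrN1 expr1n mul1r (ger0_norm la0) normfV normr_nat.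
  under eq_bigr do rewrite mulrDr mulrCA [_ * ((1 + _) * _)]mulrCA.
  rewrite big_split /= -!mulr_sumr; apply: lerD.
    rewrite expRD ler_wpM2l // -mulr_suml ler_wpM2r ?expR_ge0 //; exact: exp_sum_le.
  by rewrite ler_wpM2l ?addr_ge0 // exp_tail_le.
(* The Poisson moment of order N + 1 covers j <= L, the exponential tail covers j > L. *)
have step2 : G <= kap * ((t * w) ^+ N.+1 * (Cp * (expR la * la ^+ N.+1))) +
    kap * expR (c * la - 2 * L%:R).
  have Ptj j : Pt j <= kap * ((j%:R + 1) * (t * w)) ^+ N.+1 +
      kap * expR (2 * (j%:R - L%:R)).
    have [jL|Lj] := leqP j L.
      by apply: le_trans (tail1 _ jL) _; rewrite lerDl mulr_ge0 ?expR_ge0.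
    rewrite ler_wpDl ?mulr_ge0 ?exprn_ge0 ?mulr_ge0 ?addr_ge0 ?(ltW t0) ?(ltW w0) //.
    apply: le_trans (tail2 _ Lj).
    rewrite -(big_mkord xpredT (fun s => t ^+ s * c_abs R s n j)).
    rewrite [leRHS](big_cat_nat _ NL) //= lerDr; apply: sumr_ge0 => s _.
    by rewrite mulr_ge0 ?c_abs_ge0 // exprn_ge0 // ltW.
  rewrite -(cvg_lim (@Rhausdorff R) cG); apply: limr_le.
    by apply/cvg_ex; exists G.
  apply: nearW => K; rewrite /series /=; apply: le_trans (series_sum_le K la0 Ptj) _.
  rewrite (eq_bigr (fun j => kap * ((t * w) ^+ N.+1 *
      (la ^+ j / j`!%:R * (j%:R + 1) ^+ N.+1)) +
      kap * (la ^+ j / j`!%:R * expR (2 * (j%:R - L%:R))))); last first.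
    move=> j _; rewrite [((_ + 1) * _) ^+ _]exprMn mulrDr; congr (_ + _); last exact: mulrCA.
    by rewrite mulrCA; congr (_ * _); rewrite mulrA mulrC.
  rewrite big_split /= -!mulr_sumr; apply: lerD; rewrite ler_wpM2l //.
    by rewrite ler_wpM2l ?exprn_ge0 ?mulr_ge0 ?(ltW t0) ?(ltW w0) // moment.
  exact: exp_tail_le.
pose T := expR (- la) * (la * l / w) ^+ N.+1.
(* 1/n = (1/w)(1/w) <= la l / w, so e^{-la} n^{-N-1} fits in the target error. *)
have small : expR (- la) * expR (- (N.+1%:R * l)) <= T.
  rewrite ler_wpM2l ?expR_ge0 // -mulrN expRM_natl lerXn2r ?nnegrE ?expR_ge0 //.
    by rewrite divr_ge0 ?mulr_ge0 ?(ltW w0) //; lra.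
  rewrite expRN lnK ?posrE // -wE expr2 invfM; apply: ler_pM; rewrite ?invr_ge0 ?(ltW w0) //.
  apply: (@le_trans _ _ 1); first by rewrite invf_le1.
  nra.
have e1 : expR (la - L%:R) <= T.
  apply: le_trans small; rewrite -expRD ler_expR.
  have := xL; rewrite /x; nra.
have e2 : expR (c * la - 2 * L%:R) <= T.
  apply: le_trans small; rewrite -expRD ler_expR.
  have := xL; rewrite /x; nra.
(* The e^{la} of the moment against e^{-2 la} leaves e^{-la}, and t w <= l / w yields the target
   power. For the exponential tail, e^{-2 la} <= 1 is enough. *)
have vPT : `|vP| <= kap * Cp * T + kap * T.
  apply: le_trans vG _; apply: le_trans (ler_wpM2l (expR_ge0 _) step2) _.
  rewrite mulrDr; apply: lerD.
    rewrite [leLHS](_ : _ = kap * Cp * (expR (- la) * (la * (t * w)) ^+ N.+1)).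
      rewrite /T ler_wpM2l ?mulr_ge0 // ler_wpM2l ?expR_ge0 //.
      rewrite lerXn2r ?nnegrE ?divr_ge0 ?mulr_ge0 ?(ltW t0) ?(ltW w0) //; first by lra.
      by rewrite -[leRHS]mulrA ler_wpM2l.
    rewrite (_ : - (2 * la) = - la + - la); last by lra.
    rewrite expRD [(la * _) ^+ _]exprMn; have := expRxMexpNx_1 la.
    move: (expR la) (expR (- la)) => a b ab.
    rewrite (_ : b * b * _ = (a * b) * (kap * Cp * (b * (la ^+ N.+1 * (t * w) ^+ N.+1)))).
      by rewrite ab mul1r.
    by ring.
  apply: (@le_trans _ _ (kap * expR (c * la - 2 * L%:R))).
    rewrite ler_piMl ?mulr_ge0 ?expR_ge0 // expR_le1; lra.
  by rewrite ler_wpM2l.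
rewrite -/T; have : `|Snk R n k - S_ee R N n k| <= bnd1 + `|vP|.
  rewrite -[X in `|X|](subrK vP) (le_trans (ler_normD _ _)) // lerD2r.
  exact: step1.
move=> /le_trans; apply; rewrite /bnd1.
have k1 : kap * expR (la - L%:R) <= kap * T by rewrite ler_wpM2l.
have k2 : (1 + kap) * expR (c * la - 2 * L%:R) <= (1 + kap) * T.
  by rewrite ler_wpM2l ?addr_ge0.
by lra.
Qed.

Theorem theorem7 (R : realType) (N : nat) (hN : odd N) :
  (forall n k : nat, (0 < n)%N -> (0 < k)%N ->
     (n%:R / lambertW (n%:R : R) <= k%:R /\
      (k%:R : R) <= 2 * n%:R / (ln (n%:R : R) + 6))
     <->
     (1 <= lambda R n k /\
      lambda R n k <=
        2 / expR 3 * (Num.sqrt (n%:R : R) / (ln (n%:R : R) + 6))))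
  /\
  (exists C : R, forall n k : nat, (0 < n)%N -> (0 < k)%N ->
     n%:R / lambertW (n%:R : R) <= k%:R ->
     (k%:R : R) <= 2 * n%:R / (ln (n%:R : R) + 6) ->
     `|Snk R n k - S_ee R N n k| <=
       C * (expR (- lambda R n k) *
            (lambda R n k * ln (n%:R : R) / Num.sqrt (n%:R : R)) ^+ N.+1)).
Proof.
split=> [n k n0 k0|]; first by rewrite lambda_ge1E // lambda_leE.
have [C hC] := error_bound R N; exists C => n k n0 k0.
by rewrite lambda_ge1E //; exact: hC.
Qed.
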